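(* Let $n\ge 1$, let $\mathcal{E}_1$ and $\mathcal{E}_2$ be Hilbert spaces, let $k$ be a regular kernel on $\mathbb{B}^n$, and let \[ k(\bm{z}, \bm{w}) = k_1(\bm{z}, \bm{w}) \tilde{k}(\bm{z}, \bm{w}) \qquad (\bm{z}, \bm{w} \in \mathbb{B}^n), \] for some kernel $\tilde{k}$ on $\mathbb{B}^n$. Let $m\ge 1$ and suppose $\{\bm{z}_i\}_{i=1}^m \subseteq \mathbb{B}^n$ and $\{W_i\}_{i=1}^m \subseteq \mathcal{B}_1(\mathcal{E}_1, \mathcal{E}_2)$. Then the following conditions are equivalent: (i) There exists a multiplier $\Phi \in \mathcal{M}_1 (H^2_n \otimes \mathcal{E}_1, \mathcal{H}_k \otimes \mathcal{E}_2)$ such that $\Phi(\bm{z}_{i}) = W_{i}$ for all $i = 1, \ldots, m$. (ii) $\displaystyle \sum_{1 \leq i, j \leq m} \Big\langle \Big(k(\bm{z}_i, \bm{z}_j) I_{\mathcal{E}_2} - \frac{W_i W^*_j}{1-\langle \bm{z}_{i}, \bm{z}_{j} \rangle}\Big) \eta_j, \eta_i \Big\rangle \ge 0$ for all $\eta_1, \ldots, \eta_m \in \mathcal{E}_2$. (iii) There exists a multiplier $\tilde{\Phi} \in \mathcal{M}_1(H^2_n \otimes \mathcal{E}_1, H^2_n \otimes (\mathcal{H}_{\tilde{k}} \otimes \mathcal{E}_2))$ such that \[ \Psi_k(\bm{z}_i) \tilde{\Phi}(\bm{z}_i) = W_i \qquad (i=1, \ldots, m). \]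
   Context: All Hilbert spaces are complex, and $\mathcal{B}(\mathcal{H},\mathcal{K})$ denotes the bounded linear operators from $\mathcal{H}$ to $\mathcal{K}$; $\mathcal{B}_1(\mathcal{E}_1,\mathcal{E}_2)=\{A\in\mathcal{B}(\mathcal{E}_1,\mathcal{E}_2):\|A\|<1\}$ is the open unit ball. $\mathbb{B}^n = \{\bm{z} \in \mathbb{C}^n : \sum_{i=1}^n |z_i|^2 < 1\}$ and $\langle\bm{z},\bm{w}\rangle=\sum_{i=1}^n z_i\bar{w}_i$ for $\bm{z},\bm{w}\in\mathbb{C}^n$. A kernel on $\mathbb{B}^n$ is a positive (semi-)definite function $\mathbb{B}^n\times\mathbb{B}^n\to\mathbb{C}$; $\mathcal{H}_k$ denotes the reproducing kernel Hilbert space with kernel $k$. The Drury-Arveson space $H^2_n$ is the reproducing kernel Hilbert space on $\mathbb{B}^n$ with kernel $k_1(\bm{z},\bm{w}) = (1 - \langle\bm{z},\bm{w}\rangle)^{-1}$. A kernel $k:\mathbb{B}^n\times\mathbb{B}^n\to\mathbb{C}$, analytic in the first variables $z_1,\dots,z_n$, is called regular if there is a kernel $\tilde{k}:\mathbb{B}^n\times\mathbb{B}^n\to\mathbb{C}$, analytic in $z_1,\dots,z_n$, such that $k = k_1\tilde{k}$ on $\mathbb{B}^n\times\mathbb{B}^n$. For a Hilbert space $\mathcal{E}$, the Hilbert space tensor product $\mathcal{H}_k\otimes\mathcal{E}$ is identified with the reproducing kernel Hilbert space of $\mathcal{E}$-valued functions on $\mathbb{B}^n$ with kernel $k(\bm{z},\bm{w})I_{\mathcal{E}}$.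 In particular $H^2_n\otimes(\mathcal{H}_{\tilde k}\otimes\mathcal{E}_2)$ is regarded as a space of functions on $\mathbb{B}^n$ with values in the Hilbert space $\mathcal{H}_{\tilde k}\otimes\mathcal{E}_2$. For Hilbert spaces $\mathcal{F}_1,\mathcal{F}_2$ and a regular kernel $\ell$ (possibly $\ell=k_1$), a function $\Phi:\mathbb{B}^n\to\mathcal{B}(\mathcal{F}_1,\mathcal{F}_2)$ is a multiplier from $H^2_n\otimes\mathcal{F}_1$ to $\mathcal{H}_\ell\otimes\mathcal{F}_2$ if the pointwise product $\Phi F$, $(\Phi F)(\bm{w})=\Phi(\bm{w})F(\bm{w})$, lies in $\mathcal{H}_\ell\otimes\mathcal{F}_2$ for every $F\in H^2_n\otimes\mathcal{F}_1$; $M_\Phi$ denotes the resulting bounded multiplication operator. $\mathcal{M}_1(H^2_n\otimes\mathcal{F}_1,\mathcal{H}_\ell\otimes\mathcal{F}_2)$ is the set of such multipliers with $\|M_\Phi\|\le 1$. For $\bm{z}\in\mathbb{B}^n$ let $ev(\bm{z}):\mathcal{H}_{\tilde k}\to\mathbb{C}$, $ev(\bm{z})(f)=f(\bm{z})$, be the evaluation map. The function $\Psi_k:\mathbb{B}^n\to\mathcal{B}(\mathcal{H}_{\tilde k}\otimes\mathcal{E}_2,\mathcal{E}_2)$ is defined by $\Psi_k(\bm{z})=ev(\bm{z})\otimes I_{\mathcal{E}_2}$, i.e. $\Psi_k(\bm{z})(f\otimes\eta)=f(\bm{z})\eta$. *)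

(* Defs.v *)
From HB Require Import structures.
From mathcomp Require Import all_boot all_order all_algebra.
From mathcomp Require Import all_classical all_reals all_analysis.
From mathcomp Require Import complex.

Set Implicit Arguments.
Unset Strict Implicit.
Unset Printing Implicit Defensive.

Import Order.TTheory GRing.Theory Num.Theory.
Import numFieldNormedType.Exports.

Local Open Scope complex_scope.
Local Open Scope classical_set_scope.
Local Open Scope ring_scope.

(* [inner x y] is linear in [x] and conjugate-linear in [y]. *)
HB.mixin Record isHilbert (R : realType) V
    of CompleteNormedModule (R[i] : numFieldType) V := {
  inner : {dot V for @Num.conj R[i]} ;
  innerxx : forall x : V, inner x x = `|x| ^+ 2
}.

#[short(type="hilbertType")]
HB.structure Definition Hilbert (R : realType) :=
  {V of isHilbert R V & CompleteNormedModule (R[i] : numFieldType) V}.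

Section BoundedOperators.
Context {R : realType}.

(* For linear maps between normed spaces, continuity is boundedness, see
   [linear_bounded_continuous]. *)
Record bounded_op (H K : hilbertType R) := BoundedOp {
  bop_lin :> {linear H -> K} ;
  bop_continuous : continuous bop_lin
}.

(* The norm of a Hilbert space takes its values in [R[i]], hence [complex.Re].
   The supremum is extended-real valued: it is [+oo] on unbounded maps. *)
Definition opnorm (H K : hilbertType R) (A : H -> K) : \bar R :=
  ereal_sup [set (complex.Re `|A x|)%:E | x in [set x : H | `|x| <= 1]].

(* The map picked by [get] exists and is unique, by the Riesz representation
   theorem. *)
Definition adjoint (H K : hilbertType R) (A : bounded_op H K) :
    {linear K -> H} :=
  get (fun B : {linear K -> H} =>
    forall x y, inner (A x) y = inner x (B y)).

End BoundedOperators.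

Section Kernels.
Context {R : realType}.

(* [0 <= z] in [R[i]] says that [z] is real and nonnegative. *)
Definition is_kernel (X : Type) (k : X -> X -> R[i]) :=
  forall (N : nat) (x : 'I_N -> X) (c : 'I_N -> R[i]),
    0 <= \sum_(i < N) \sum_(j < N) (c i)^* * c j * k (x i) (x j).

(* A model of the reproducing kernel Hilbert space with kernel [k]: a Hilbert
   space whose elements are functions on [X] (injectivity of [fun_of]) and which
   contains every [k(., w)], with the reproducing property.  A model exists when
   [k] is a kernel (Moore-Aronszajn), and any two models are related by a unique
   isometric isomorphism preserving [fun_of]. *)
Record rkhs (X : Type) (k : X -> X -> R[i]) := Rkhs {
  rkhs_space :> hilbertType R ;
  fun_of : rkhs_space -> X -> R[i] ;
  fun_of_linear : forall (a : R[i]) f g x,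
    fun_of (a *: f + g) x = a * fun_of f x + fun_of g x ;
  fun_of_inj : injective fun_of ;
  fun_of_reproducing : forall w, exists k_w : rkhs_space,
    (forall z, fun_of k_w z = k z w) /\
    (forall f, inner f k_w = fun_of f w)
}.

(* A model of the Hilbert space tensor product, i.e. a completion of the
   algebraic tensor product, again unique up to a unique isomorphism. *)
Record htensor (H K : hilbertType R) := HTensor {
  htensor_space :> hilbertType R ;
  tensor : {bilinear H -> K -> htensor_space} ;
  inner_tensor : forall f g x y,
    inner (tensor f x) (tensor g y) = inner f g * inner x y ;
  tensor_dense : dense [set F | exists N (f : 'I_N -> H) (x : 'I_N -> K),
    F = \sum_(i < N) tensor (f i) (x i)]
}.

(* The operator [ev(z) (x) I_E : H_k (x) E -> E], [f (x) x |-> f(z) x].  It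
   realizes the identification of [H_k (x) E] with a space of [E]-valued
   functions: the function associated with [F] is [z |-> ev_tensor T z F].
   Uniqueness follows from [tensor_dense]; the operator exists because it is the
   adjoint of [x |-> k(., z) (x) x]. *)
Definition ev_tensor (X : Type) (k : X -> X -> R[i]) (Hk : rkhs k)
    (E : hilbertType R) (T : htensor Hk E) (z : X) : {linear T -> E} :=
  get (fun S : {linear T -> E} =>
    continuous S /\ forall f x, S (tensor T f x) = fun_of f z *: x).

End Kernels.

Section Multipliers.
Context {R : realType} {X : Type} {k l : X -> X -> R[i]}.
Context {Hk : rkhs k} {Hl : rkhs l} {F1 F2 : hilbertType R}.
Variables (T1 : htensor Hk F1) (T2 : htensor Hl F2).
Implicit Type Phi : X -> bounded_op F1 F2.

Definition is_product Phi (F : T1) (G : T2) :=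
  forall w, ev_tensor T2 w G = Phi w (ev_tensor T1 w F).

Definition is_multiplier Phi := forall F, exists G, is_product Phi F G.

(* [M_Phi]: for a multiplier [Phi] the product exists, and it is unique since
   an element of [T2] is determined by its values. *)
Definition mulop Phi (F : T1) : T2 := get (is_product Phi F).

Definition multiplier1 Phi := is_multiplier Phi /\ (opnorm (mulop Phi) <= 1)%E.

End Multipliers.

Section Ball.
Context {R : realType} {n : nat}.

Definition cdot (z w : 'rV[R[i]]_n) : R[i] := \sum_(i < n) z 0 i * (w 0 i)^*.

Definition unit_ball := {z : 'rV[R[i]]_n | \sum_(i < n) `|z 0 i| ^+ 2 < 1}.

Definition drury_arveson (z w : unit_ball) : R[i] :=
  (1 - cdot (val z) (val w))^-1.

(* Analytic on the open ball: complex (Frechet) differentiable at each of its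
   points; linear maps here are linear over [R[i]].
   The values of [g] outside the ball are irrelevant. *)
Definition analytic (f : unit_ball -> R[i]) :=
  exists g : 'rV[R[i]]_n -> R[i]^o,
    forall z : unit_ball, g (val z) = f z /\ differentiable g (val z : 'rV[R[i]^o]_n).

Definition analytic_kernel (k : unit_ball -> unit_ball -> R[i]) :=
  is_kernel k /\ forall w, analytic (k^~ w).

Definition regular_kernel (k : unit_ball -> unit_ball -> R[i]) :=
  analytic_kernel k /\
  exists2 kt, analytic_kernel kt &
    forall z w, k z w = drury_arveson z w * kt z w.

End Ball.

Arguments unit_ball R n : clear implicits.

(* Main.v *)
(* Multipliers are handled through one criterion: [Phi] is a contractive
   multiplier iff [l_w (x) y |-> k_w (x) Phi(w)^* y] does not increase norms of
   finite sums.  Applied at the points [z_i] it gives (i) -> (ii), and since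
   [k = k_1 kt] the vectors [k_w (x) y] and [k1_w (x) (kt_w (x) y)] have the same
   Gram matrix, which gives (iii) -> (i).  For (ii) -> (iii), write
   [A_j y = kt_(z_j) (x) y] and [B_j = W_j^*].  Condition (ii) says that
   [T : k1_(z_j) (x) A_j y |-> k1_(z_j) (x) B_j y] extends to a contraction; with
   [D = (1 - T^* T)^(1/2)] and [L_j y = D (k1_(z_j) (x) A_j y)] one gets
   [A_i^* A_j - B_i^* B_j = (1 - <z_i, z_j>) L_i^* L_j], so that
   [((conj z_j) (x) L_j y, A_j y) |-> (L_j y, B_j y)] is isometric.  A contractive
   extension [U] of it is a colligation whose transfer function is [Phit^*]; that
   function is a contractive multiplier because [k1 >= 0] and Schur products of
   positive kernels are positive. *)
From HB Require Import structures.
Require Import Defs.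
From mathcomp Require Import all_boot all_order all_algebra.
From mathcomp Require Import all_classical all_reals all_analysis.
From mathcomp Require Import ssrAC complex ring lra.
Import Order.TTheory GRing.Theory Num.Theory.
Import numFieldNormedType.Exports.
Local Open Scope complex_scope.
Local Open Scope classical_set_scope.
Local Open Scope ring_scope.

Set Implicit Arguments.
Unset Strict Implicit.
Unset Printing Implicit Defensive.

(** * Real-valued norms and inner products *)

Section RealNorm.
Context {R : realType}.

(** Norms over [R[i]] take values in [R[i]]; this version lies in the ordered field [R], where all
    estimates are carried out. *)
Definition rnorm (V : normedZmodType R[i]) (x : V) : R := complex.Re `|x|.

Lemma rnormE (V : normedZmodType R[i]) (x : V) : (rnorm x)%:C = `|x|.
Proof. by rewrite /rnorm RRe_real// normr_real. Qed.

Lemma rnorm_ge0 (V : normedZmodType R[i]) (x : V) : 0 <= rnorm x.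
Proof. by rewrite -ler0c rnormE. Qed.

Lemma rnorm0 (V : normedZmodType R[i]) : rnorm (0 : V) = 0.
Proof. by apply: complexI; rewrite rnormE normr0. Qed.

Lemma rnorm0_eq0 (V : normedZmodType R[i]) (x : V) : rnorm x = 0 -> x = 0.
Proof. by move=> x0; apply/eqP; rewrite -normr_eq0 -rnormE x0. Qed.

Lemma ler_rnormD (V : normedZmodType R[i]) (x y : V) :
  rnorm (x + y) <= rnorm x + rnorm y.
Proof. by rewrite -lecR rmorphD/= !rnormE ler_normD. Qed.

Lemma rnormN (V : normedZmodType R[i]) (x : V) : rnorm (- x) = rnorm x.
Proof. by rewrite /rnorm normrN. Qed.

Lemma rnormB (V : normedZmodType R[i]) (x y : V) :
  rnorm (x - y) = rnorm (y - x).
Proof. by rewrite /rnorm distrC. Qed.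

Lemma ler_rdist (V : normedZmodType R[i]) (z x y : V) :
  rnorm (x - y) <= rnorm (x - z) + rnorm (z - y).
Proof. by rewrite -[x in X in X <= _](subrK z) -addrA ler_rnormD. Qed.

Lemma rnormZ (V : normedModType R[i]) (a : R[i]) (x : V) :
  rnorm (a *: x) = rnorm a * rnorm x.
Proof. by apply: complexI; rewrite rmorphM/= !rnormE normrZ. Qed.

Lemma rnormM (a b : R[i]) : rnorm (a * b) = rnorm a * rnorm b.
Proof. by apply: complexI; rewrite rmorphM/= !rnormE normrM. Qed.

Lemma rnorm_conj (a : R[i]) : rnorm a^* = rnorm a.
Proof. by apply: complexI; rewrite !rnormE norm_conjC. Qed.

Lemma rnorm_real (a : R) : 0 <= a -> rnorm a%:C = a.
Proof. by move=> a0; apply: complexI; rewrite rnormE ger0_norm// ler0c. Qed.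

Lemma half_realE : (2^-1 : R[i]) = (2^-1 : R)%:C.
Proof. by rewrite fmorphV rmorph_nat. Qed.

Lemma rnorm_half : rnorm (2^-1 : R[i]) = 2^-1.
Proof. by rewrite half_realE rnorm_real// invr_ge0. Qed.

Lemma Re_le_rnorm (a : R[i]) : complex.Re a <= rnorm a.
Proof.
rewrite (le_trans (ler_norm _))// -lecR rnormE; exact: normc_ge_Re.
Qed.

(* Weaker than convergence to [0]: one small value suffices, because the bounds
   [e n] below control every later term as well. *)
Definition vanishing (e : nat -> R) := forall d, 0 < d -> exists n, e n < d.

Lemma vanishingM (c : R) (e : nat -> R) :
  0 <= c -> vanishing e -> vanishing (fun n => c * e n).
Proof.
rewrite le_eqVlt => /orP[/eqP <- _ d d0|c0 ve d d0].
  by exists 0%N; rewrite mul0r.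
have [n en] := ve (d / c) (divr_gt0 d0 c0).
by exists n; rewrite mulrC -ltr_pdivlMr.
Qed.

Lemma vanishing_le0 (a : R) (e : nat -> R) :
  vanishing e -> (forall n, a <= e n) -> a <= 0.
Proof.
move=> ve ae; rewrite leNgt; apply/negP => /ve[n]; rewrite ltNge.
by rewrite ae.
Qed.

Lemma vanishing_eq0 (V : normedZmodType R[i]) (x : V) (e : nat -> R) :
  vanishing e -> (forall n, rnorm x <= e n) -> x = 0.
Proof.
move=> ve xe; apply: rnorm0_eq0; apply/eqP.
by rewrite eq_le rnorm_ge0 (vanishing_le0 ve xe).
Qed.

Lemma harmonic_vanishing : vanishing (fun n => n.+1%:R^-1).
Proof.
move=> d d0; exists (Num.bound d^-1).
rewrite -[ltRHS]invrK ltf_pV2 ?posrE ?invr_gt0 ?ltr0n//.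
rewrite (lt_trans (archi_boundP _)) ?invr_ge0 1?ltW// ltr_nat//.
Qed.

(** [e n] bounds every later difference, so the same rate bounds the distance to the limit. Limits
    are thus used through explicit inequalities only. *)
Lemma rapid_cauchy_limit (H : completeNormedModType R[i]) (u : nat -> H)
    (e : nat -> R) : vanishing e ->
  (forall n p, (n <= p)%N -> rnorm (u p - u n) <= e n) ->
  exists h, forall n, rnorm (h - u n) <= e n.
Proof.
move=> ve ue.
have uc : cvgn u.
  apply/cauchy_cvgP/cauchy_exP => d d0.
  have d0' : 0 < complex.Re d by move: d0; rewrite ltcE => /andP[].
  have [n en] := ve _ d0'.
  exists (u n), n => //= p np; rewrite -ball_normE/= -rnormE.
  have -> : d = (complex.Re d)%:C by rewrite RRe_real// gtr0_real.
  by rewrite ltcR rnormB (le_lt_trans _ en)//; apply: ue.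
exists (limn u) => n; rewrite leNgt; apply/negP => h.
(* The gap by which the bound would fail serves as tolerance; a term past both [N] and [n] then
   gives a contradiction. *)
have /cvgrPdist_lt/(_ ((rnorm (limn u - u n) - e n)%:C)) := uc.
rewrite (ltcR 0) subr_gt0 => /(_ h)[N _ hN].
have := hN (maxn N n) (leq_maxl _ _); rewrite /= -rnormE ltcR => h2.
have := ue n (maxn N n) (leq_maxr _ _).
have := ler_rdist (u (maxn N n)) (limn u) (u n).
by lra.
Qed.

End RealNorm.

(** * Cauchy-Schwarz inequality and norm of an abstract dot product *)

Section DotNorm.
Context {R : realType} {U : lmodType R[i]} (f : {dot U for @Num.conj R[i]}).

(** Provides the norm of the direct sums [hsum], where only a dot product is given at first; it has
    values in [R[i]], as norms over [R[i]] must. *)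
Definition dot_norm (x : U) : R[i] := (Num.sqrt (complex.Re (f x x)))%:C.

Lemma dot_normE (x : U) : dot_norm x ^+ 2 = f x x.
Proof.
have fx : 0 <= f x x by exact: dnorm_ge0.
have fx' : 0 <= complex.Re (f x x) by move: fx; rewrite lecE => /andP[].
by rewrite -rmorphXn/= sqr_sqrtr// RRe_real// ger0_real.
Qed.

Lemma dot_norm_ge0 (x : U) : 0 <= dot_norm x.
Proof. by rewrite ler0c sqrtr_ge0. Qed.

Lemma dot_cauchy_schwarz (x y : U) : `|f x y| <= dot_norm x * dot_norm y.
Proof.
rewrite -ler_sqr ?nnegrE ?mulr_ge0 ?dot_norm_ge0// exprMn !dot_normE.
have [->|y0] := eqVneq y 0; first by rewrite !linear0r normr0 expr0n.
have yy : 0 < f y y by rewrite dnorm_gt0.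
pose w := x - (f x y / f y y) *: y.
have wy : f w y = 0 by rewrite linearBl linearZl_LR/= divfK ?gt_eqF// subrr.
have : 0 <= f w w by exact: dnorm_ge0.
rewrite {2}/w linearBr linearZr_LR/= wy mulr0 subr0 linearBl linearZl_LR/=.
have -> : f y x = (f x y)^* by rewrite hermC expr0 mul1r.
by rewrite subr_ge0 mulrAC -normCK ler_pdivrMr.
Qed.

Lemma ler_dot_normD (x y : U) : dot_norm (x + y) <= dot_norm x + dot_norm y.
Proof.
rewrite -ler_sqr ?nnegrE ?addr_ge0 ?dot_norm_ge0// dot_normE dnormD.
rewrite sqrrD !dot_normE addrAC lerD2r lerD2l.
rewrite (_ : (f x y)^* = conjc (f x y))// addcJ -[leRHS]mulr_natl ler_wpM2l//.
apply: le_trans (dot_cauchy_schwarz x y); apply: le_trans (normc_ge_Re _).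
by rewrite lecR ler_norm.
Qed.

Lemma dot_normZ (a : R[i]) (x : U) : dot_norm (a *: x) = `|a| * dot_norm x.
Proof.
apply/eqP; rewrite -(@eqrXn2 _ 2) ?mulr_ge0 ?dot_norm_ge0//.
by rewrite exprMn !dot_normE dnormZ.
Qed.

Lemma dot_norm0_eq0 (x : U) : dot_norm x = 0 -> x = 0.
Proof.
by move=> x0; apply/eqP; rewrite -(dnorm_eq0 f) -dot_normE x0 expr0n.
Qed.

End DotNorm.

Section Inner.
Context {R : realType}.
Implicit Type H : hilbertType R.

Lemma innerDl H (x y z : H) : inner (x + y) z = inner x z + inner y z.
Proof. exact: linearDl. Qed.

Lemma innerDr H (x y z : H) : inner x (y + z) = inner x y + inner x z.
Proof. by rewrite linearD. Qed.

Lemma innerZl H (a : R[i]) (x y : H) : inner (a *: x) y = a * inner x y.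
Proof. exact: linearZl_LR. Qed.

Lemma innerZr H (a : R[i]) (x y : H) : inner x (a *: y) = a^* * inner x y.
Proof. by rewrite linearZr_LR. Qed.

Lemma innerC H (x y : H) : inner y x = (inner x y)^*.
Proof. by rewrite hermC expr0 mul1r. Qed.

Lemma inner0l H (x : H) : inner 0 x = 0.
Proof. by rewrite -(scale0r (0 : H)) innerZl mul0r. Qed.

Lemma inner0r H (x : H) : inner x 0 = 0.
Proof. by rewrite innerC inner0l rmorph0. Qed.

Lemma innerNl H (x y : H) : inner (- x) y = - inner x y.
Proof. by rewrite -scaleN1r innerZl mulN1r. Qed.

Lemma innerNr H (x y : H) : inner x (- y) = - inner x y.
Proof. by rewrite -scaleN1r innerZr rmorphN1 mulN1r. Qed.

Lemma innerBl H (x y z : H) : inner (x - y) z = inner x z - inner y z.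
Proof. by rewrite innerDl innerNl. Qed.

Lemma innerBr H (x y z : H) : inner x (y - z) = inner x y - inner x z.
Proof. by rewrite innerDr innerNr. Qed.

Lemma inner_suml H (I : Type) (r : seq I) (P : pred I) (F : I -> H) (y : H) :
  inner (\sum_(i <- r | P i) F i) y = \sum_(i <- r | P i) inner (F i) y.
Proof.
by apply: (big_morph (fun x => inner x y)) => [u v|];
  rewrite ?innerDl ?inner0l.
Qed.

Lemma inner_sumr H (I : Type) (r : seq I) (P : pred I) (F : I -> H) (x : H) :
  inner x (\sum_(i <- r | P i) F i) = \sum_(i <- r | P i) inner x (F i).
Proof.
by apply: (big_morph (inner x)) => [u v|]; rewrite ?innerDr ?inner0r.
Qed.

Lemma inner_sqr H (x : H) : inner x x = ((rnorm x) ^+ 2)%:C.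
Proof. by rewrite innerxx rmorphXn/= rnormE. Qed.

Lemma inner_ge0 H (x : H) : 0 <= inner x x.
Proof. by rewrite innerxx exprn_ge0. Qed.

Lemma inner_eq0 H (x : H) : inner x x = 0 -> x = 0.
Proof.
by rewrite innerxx => /eqP; rewrite expf_eq0/= normr_eq0 => /eqP.
Qed.

Lemma inner_ext H (x y : H) : (forall z, inner x z = inner y z) -> x = y.
Proof.
move=> xy; apply/eqP; rewrite -subr_eq0; apply/eqP/inner_eq0.
by rewrite innerBl xy subrr.
Qed.

Lemma ler_inner H1 H2 (x : H1) (y : H2) :
  (inner x x <= inner y y) = (rnorm x <= rnorm y).
Proof. by rewrite !inner_sqr lecR ler_sqr ?nnegrE ?rnorm_ge0. Qed.

Lemma cauchy_schwarz H (x y : H) : rnorm (inner x y) <= rnorm x * rnorm y.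
Proof.
have dotE (z : H) : dot_norm (@inner R H) z = `|z|.
  by apply/eqP; rewrite -(@eqrXn2 _ 2) ?dot_norm_ge0// dot_normE innerxx.
have := dot_cauchy_schwarz (@inner R H) x y.
by rewrite !dotE -!rnormE -rmorphM/= lecR.
Qed.

End Inner.

(** * Riesz representation, adjoints and contractive extension *)

Section Riesz.
Context {R : realType}.
Implicit Type H : hilbertType R.

Lemma rnormD_sqr H (x y : H) :
  rnorm (x + y) ^+ 2 = rnorm x ^+ 2 + rnorm y ^+ 2 + 2 * complex.Re (inner y x).
Proof.
apply: complexI; rewrite -inner_sqr !rmorphD/= -!inner_sqr innerDl !innerDr.
rewrite (innerC y x) (_ : (inner y x)^* = conjc (inner y x))//.
rewrite rmorphM rmorph_nat.
by rewrite -addcJ; ring.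
Qed.

(** Stands for a linear map defined on a subspace that need not be closed. A bound on [b] by [s]
    forces it to be single-valued. *)
Definition linear_relation (U V : lmodType R[i]) (G : U -> V -> Prop) :=
  G 0 0 /\ forall a s t b b', G s b -> G t b' -> G (a *: s + t) (a *: b + b').

(* [h] minimizes [|s|^2 - 2 Re b] over the pairs of [G], in the closure of its
   domain. *)
Lemma linear_relation_riesz H (G : H -> R[i]^o -> Prop) (c : R) : 0 <= c ->
  linear_relation G -> (forall s b, G s b -> rnorm b <= c * rnorm s) ->
  exists h, [/\ forall s b, G s b -> inner s h = b,
    rnorm h <= c & forall d, 0 < d -> exists s b, G s b /\ rnorm (h - s) <= d].
Proof.
move=> c0 [G0 Glin] Gc.
pose J (s : H) (b : R[i]) : R := rnorm s ^+ 2 - 2 * complex.Re b.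
pose A := [set r | exists s b, G s b /\ r = J s b].
have infA : has_inf A.
  split; first by exists (J 0 0), 0, 0.
  (* With [r = |s|], [J s b] is at least [r^2 - 2 c r = (r - c)^2 - c^2]. *)
  exists (- c ^+ 2) => _ [s [b [Gsb ->]]]; rewrite /J.
  have := Re_le_rnorm b; have := Gc _ _ Gsb.
  by have := sqr_ge0 (rnorm s - c); nra.
have Jge s b : G s b -> inf A <= J s b.
  by move=> Gsb; apply: (ge_inf infA.2); exists s, b.
pose e n : R := n.+1%:R^-1.
have e0 n : 0 < e n by rewrite invr_gt0 ltr0n.
have ve : vanishing e := harmonic_vanishing.
have /choice[p pP] n : exists p : H * R[i],
    G p.1 p.2 /\ J p.1 p.2 <= inf A + (e n / 2) ^+ 2.
  have [|r [s [b [Gsb ->]]] Jlt] := @inf_adherent _ A ((e n / 2) ^+ 2) _ infA.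
    by rewrite exprn_gt0// divr_gt0.
  by exists (s, b); split=> //; exact: ltW.
(* The midpoint of two pairs of [G] is in [G], so its [J] is at least [inf A]; the parallelogram
   identity then bounds the distance. The excess [(e n / 2)^2] allowed above makes that distance at
   most [e n]. *)
have parallelogram s t b b' : G s b -> G t b' ->
    rnorm (s - t) ^+ 2 <= 2 * (J s b - inf A) + 2 * (J t b' - inf A).
  move=> Gs Gt.
  have := Jge _ _ (Glin 2^-1 _ _ _ _ (Glin 1 _ _ _ _ Gs Gt) G0).
  rewrite !addr0 !scale1r /J rnormZ rnorm_half.
  have -> : complex.Re (2^-1 *: (b + b')) =
      2^-1 * (complex.Re b + complex.Re b').
    rewrite half_realE.
    case: b {Gs} => ? ?; case: b' {Gt} => ? ?.
    by rewrite /= /GRing.scale/=; ring.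
  rewrite exprMn !rnormD_sqr rnormN innerNl raddfN/=.
  by lra.
have [h hP] : exists h, forall n, rnorm (h - (p n).1) <= e n.
  apply: rapid_cauchy_limit ve _ => n q nq.
  rewrite -ler_sqr ?nnegrE ?rnorm_ge0 ?(ltW (e0 n))//.
  apply: le_trans (parallelogram _ _ _ _ (pP q).1 (pP n).1) _.
  have eq : e q <= e n by rewrite /e lef_pV2 ?posrE ?ltr0n// ler_nat.
  have := (pP q).2; have := (pP n).2; have := e0 q; have := e0 n; nra.
have hG s b : G s b -> inner s h = b.
  move=> Gsb; pose T := rnorm s ^+ 2 + 1.
  have T0 : 0 < T by rewrite ltr_wpDl// sqr_ge0.
  apply/eqP; rewrite -subr_eq0; apply/eqP.
  apply: (vanishing_eq0 (e := fun n => (rnorm s + T) * e n)).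
    by apply: vanishingM => //; rewrite addr_ge0 ?rnorm_ge0 ?ltW.
  move=> n; rewrite mulrDl.
  have -> : inner s h - b = inner s (h - (p n).1) + (inner s (p n).1 - b).
    by rewrite innerBr; ring.
  apply: le_trans (ler_rnormD _ _) _; apply: lerD.
    apply: le_trans (cauchy_schwarz _ _) _.
    by rewrite ler_wpM2l ?rnorm_ge0.
  set d := _ - b.
  (* The almost minimizing pair is moved along [s] by [- d^* / T]: this changes [J] by
     [- 2 |d|^2 / T] plus at most [|d|^2 / T], so [d] is small. Adding 1 in [T] covers [s = 0] and
     gives [T <= T^2] at the end. *)
  have := Jge _ _ (Glin (- (T^-1)%:C * d^*) _ _ _ _ Gsb (pP n).1).
  rewrite addrC /J rnormD_sqr innerZl rnormZ.
  rewrite rnormM rnormN rnorm_real ?invr_ge0 ?(ltW T0)// rnorm_conj.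
  have -> : complex.Re (- (T^-1)%:C * d^* *: (b : R[i]^o) + (p n).2) =
     complex.Re (- (T^-1)%:C * d^* * b) + complex.Re (p n).2 by rewrite raddfD.
  have dd : complex.Re (- (T^-1)%:C * d^* * inner s (p n).1) -
      complex.Re (- (T^-1)%:C * d^* * b) = - T^-1 * rnorm d ^+ 2.
    rewrite -raddfB -mulrBr -/d -mulrA (mulrC d^*) -normCK -rnormE.
    by rewrite -rmorphXn -rmorphN -rmorphM.
  move=> h1.
  have h2 : T^-1 * rnorm d ^+ 2 * (2 - T^-1 * rnorm s ^+ 2) <= (e n / 2) ^+ 2.
    have := (pP n).2; rewrite /J; move: h1 dd; rewrite !exprMn; lra.
  have h3 : T^-1 * rnorm s ^+ 2 <= 1.
    by rewrite mulrC ler_pdivrMr// mul1r /T; lra.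
  have h4 : T^-1 * rnorm d ^+ 2 <= e n ^+ 2.
    have : 0 <= T^-1 * rnorm d ^+ 2.
      by rewrite mulr_ge0 ?sqr_ge0// invr_ge0 ltW.
    by have := e0 n; nra.
  rewrite -ler_sqr ?nnegrE ?rnorm_ge0 ?mulr_ge0// ?(ltW T0) ?(ltW (e0 n))//.
  move: h4; rewrite mulrC ler_pdivrMr// exprMn => h4.
  apply: le_trans h4 _; rewrite mulrC ler_wpM2r ?sqr_ge0//.
  by rewrite /T; have := sqr_ge0 (rnorm s); nra.
have happ d : 0 < d -> exists s b, G s b /\ rnorm (h - s) <= d.
  move=> /ve[n /ltW en]; exists (p n).1, (p n).2; split; first exact: (pP n).1.
  exact: le_trans (hP n) en.
exists h; split=> //.
(* As [h] is a limit of elements [s] of the domain, [<h, h>] is close to [<s, h> = b], and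
   [|b| <= c |s|]; in the limit [|h|^2 <= c |h|]. *)
have : rnorm h ^+ 2 - c * rnorm h <= 0.
  apply: (vanishing_le0 (e := fun n => (rnorm h + c) * e n)).
    by apply: vanishingM => //; rewrite addr_ge0 ?rnorm_ge0.
  move=> n; have [s [b [Gs hs]]] := happ _ (e0 n).
  have : rnorm (inner h h) <= rnorm (inner (h - s) h) + rnorm (inner s h).
    by rewrite innerBl -[X in rnorm X <= _](subrK (inner s h)) ler_rnormD.
  rewrite inner_sqr rnorm_real ?sqr_ge0// (hG _ _ Gs).
  have := cauchy_schwarz (h - s) h; have := Gc _ _ Gs.
  have := ler_rnormD (s - h) h; rewrite subrK rnormB.
  by have := rnorm_ge0 h; nra.
by have := rnorm_ge0 h; nra.
Qed.

End Riesz.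

Section Operators.
Context {R : realType}.
Implicit Type H K : hilbertType R.

Lemma linear_packP (U V : lmodType R[i]) (f : U -> V) :
  linear f -> exists g : {linear U -> V}, g =1 f.
Proof.
move=> fl.
by exists (HB.pack_for {linear U -> V} f
  (GRing.isLinear.Build R[i] U V *:%R f fl)).
Qed.

Lemma lipschitz_continuous H K (A : {linear H -> K}) (c : R) :
  (forall x, rnorm (A x) <= c * rnorm x) -> continuous A.
Proof.
move=> Ac; apply: bounded_linear_continuous; apply/linear_boundedP.
near=> r => x; apply: (@le_trans _ _ (c * rnorm x)%:C).
  by rewrite -rnormE lecR.
rewrite rmorphM -rnormE ler_wpM2r ?ler0c ?rnorm_ge0//.
by near: r; apply: nbhs_pinfty_ge; apply/complex_realP; exists c.
Unshelve. all: by end_near. Qed.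

Lemma continuous_lipschitz H K (A : {linear H -> K}) : continuous A ->
  exists2 c : R, 0 <= c & forall x, rnorm (A x) <= c * rnorm x.
Proof.
move=> /(_ 0)/continuous_linear_bounded/linear_boundedP/pinfty_ex_gt0[r r0 Ar].
have rE : r = (complex.Re r)%:C by rewrite RRe_real// gtr0_real.
exists (complex.Re r); first by rewrite -ler0c -rE ltW.
by move=> x; rewrite -lecR rmorphM/= -rE !rnormE.
Qed.

Lemma bounded_opP H K (f : H -> K) (c : R) :
  linear f -> (forall x, rnorm (f x) <= c * rnorm x) ->
  exists A : bounded_op H K, A =1 f.
Proof.
move=> /linear_packP[g gf] fc.
have gc : continuous g.
  by apply: (@lipschitz_continuous _ _ _ c) => x; rewrite gf.
by exists (BoundedOp gc).
Qed.

(** Riesz representation of the functionals [x |-> <A x, y>]. The constant stays explicit so that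
    adjoints of contractions are contractions. *)
Lemma adjoint_exists H K (A : {linear H -> K}) (c : R) : 0 <= c ->
  (forall x, rnorm (A x) <= c * rnorm x) ->
  exists B : bounded_op K H, (forall x y, inner (A x) y = inner x (B y)) /\
    forall y, rnorm (B y) <= c * rnorm y.
Proof.
move=> c0 Ac.
have /choice[B BP] y : exists h : H,
    (forall x, inner (A x) y = inner x h) /\ rnorm h <= c * rnorm y.
  have [|||h [hA hc _]] := @linear_relation_riesz R H
      (fun x b => b = inner (A x) y) (c * rnorm y).
  - by rewrite mulr_ge0// rnorm_ge0.
  - split; first by rewrite linear0 inner0l.
    by move=> a s t _ _ -> ->; rewrite linearP innerDl innerZl.
  - move=> s _ ->; apply: le_trans (cauchy_schwarz _ _) _.
    by rewrite mulrAC ler_wpM2r// rnorm_ge0.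
  by exists h; split=> // x; rewrite (hA x _ erefl).
have Blin : linear B.
  move=> a x y; apply: inner_ext => z; rewrite innerC -(BP _).1.
  rewrite innerDr innerZr !(BP _).1 -innerZr -innerDr -innerC.
  by [].
have [B' B'E] := bounded_opP Blin (fun y => (BP y).2).
by exists B'; split=> [x y|y]; rewrite B'E; have [] := BP y.
Qed.

(* The adjoint of the extension is obtained from the representation of the
   functionals [s |-> <k, y>], so no orthogonal projection is needed. *)
Lemma contraction_extension H K (G : H -> K -> Prop) : linear_relation G ->
  (forall s k, G s k -> rnorm k <= rnorm s) ->
  exists C : bounded_op H K, (forall x, rnorm (C x) <= rnorm x) /\
    forall s k, G s k -> C s = k.
Proof.
move=> [G0 Glin] Gc.
have /choice[M MP] y : exists h : H, [/\
    forall s k, G s k -> inner s h = inner k y, rnorm h <= rnorm y &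
    forall d : R, 0 < d -> exists s k, G s k /\ rnorm (h - s) <= d].
  have [|||h [hA hc happ]] := @linear_relation_riesz R H
      (fun s b => exists2 k, G s k & b = inner k y) (rnorm y).
  - exact: rnorm_ge0.
  - split; first by exists 0 => //; rewrite inner0l.
    move=> a s t _ _ [k Gsk ->] [l Gtl ->].
    exists (a *: k + l); first exact: Glin.
    by rewrite innerDl innerZl.
  - move=> s _ [k Gsk ->]; apply: le_trans (cauchy_schwarz _ _) _.
    by rewrite mulrC ler_wpM2l ?rnorm_ge0//; apply: Gc.
  exists h; split=> //; first by move=> s k Gsk; apply: hA; exists k.
  by move=> d /happ[s [b [[k Gsk _] hs]]]; exists s, k.
have Mlin : linear M.
  move=> a y y'; apply/eqP; rewrite -subr_eq0; apply/eqP.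
  set x := _ - _.
  (* The linearity defect [x] is orthogonal to the domain of [G] and also lies in its closure, hence
     vanishes; the approximation clause of the Riesz lemma provides the second fact. *)
  have xG s k : G s k -> inner s x = 0.
    move=> Gsk; have Ms y := let: And3 h _ _ := MP y in h _ _ Gsk.
    by rewrite innerBr innerDr innerZr !Ms innerDr innerZr subrr.
  have xapp d : 0 < d ->
      exists s k, G s k /\ rnorm (x - s) <= (2 + rnorm a) * d.
    move=> d0; have Mapp y := let: And3 _ _ h := MP y in h _ d0.
    have [s1 [k1 [G1 h1]]] := Mapp (a *: y + y').
    have [s2 [k2 [G2 h2]]] := Mapp y.
    have [s3 [k3 [G3 h3]]] := Mapp y'.
    have G23 := Glin (-1) _ _ _ _ (Glin a _ _ _ _ G2 G3) G1.
    exists (-1 *: (a *: s2 + s3) + s1), (-1 *: (a *: k2 + k3) + k1); split=> //.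
    have -> : x - (-1 *: (a *: s2 + s3) + s1) =
        (M (a *: y + y') - s1) + - (a *: (M y - s2) + (M y' - s3)).
      rewrite /x scaleN1r scalerBr !opprD !opprK.
      by rewrite [LHS](AC ((1*2)*(2*1)) ((1*6)*((2*4)*(3*5)))).
    apply: le_trans (ler_rnormD _ _) _; rewrite rnormN.
    have := ler_rnormD (a *: (M y - s2)) (M y' - s3); rewrite rnormZ.
    by have := rnorm_ge0 a; nra.
  apply: inner_eq0; apply: (vanishing_eq0
      (e := fun n => (rnorm x * (2 + rnorm a)) * n.+1%:R^-1)).
    apply: vanishingM; last exact: harmonic_vanishing.
    by rewrite mulr_ge0 ?addr_ge0 ?rnorm_ge0.
  move=> n; have [|s [k [Gsk xs]]] := xapp n.+1%:R^-1.
    by rewrite invr_gt0 ltr0n.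
  have -> : inner x x = inner (x - s) x.
    by rewrite [RHS]innerBl (xG _ _ Gsk) subr0.
  apply: le_trans (cauchy_schwarz _ _) _.
  by rewrite mulrC -mulrA ler_wpM2l ?rnorm_ge0.
have [M' M'E] := linear_packP Mlin.
have M'c y : rnorm (M' y) <= 1 * rnorm y.
  by rewrite mul1r M'E; have [] := MP y.
have [C [CP Cc]] := adjoint_exists ler01 M'c.
exists C; split=> [x|s k Gsk]; first by rewrite -[leRHS]mul1r.
apply: inner_ext => z; rewrite [LHS]innerC -CP M'E -innerC.
by have [h _ _] := MP z; apply: h.
Qed.

End Operators.

(** * Defect operators, Neumann series and Schur products *)

Section Constructions.
Context {R : realType}.
Implicit Type H K : hilbertType R.

(** The linearity defect is a combination of values of [D] and is orthogonal to all values of [D],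
    hence to itself. *)
Lemma gram_linear (U : lmodType R[i]) H (D : U -> H) (g : U -> U -> R[i]) :
  (forall u v, inner (D u) (D v) = g u v) ->
  (forall a u v w, g (a *: u + v) w = a * g u w + g v w) -> linear D.
Proof.
move=> Dg glin a u v; apply/eqP; rewrite -subr_eq0; apply/eqP.
set z := _ - _.
have zD w : inner z (D w) = 0.
  by rewrite innerBl innerDl innerZl !Dg glin subrr.
apply: inner_eq0; rewrite {2}/z.
by rewrite innerBr innerDr innerZr !zD mulr0 addr0 subr0.
Qed.

(* The iteration [Y_(n+1) = (A + Y_n^2) / 2] with [A = T^* T] converges to [Z]
   with [(1 - Z)^2 = 1 - A]; it is dominated by its scalar case [q_n], which
   increases to [1]. *)
Lemma defect_operator H K (T : bounded_op H K) :
  (forall x, rnorm (T x) <= rnorm x) ->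
  exists D : {linear H -> H}, forall u v,
    inner (D u) (D v) = inner u v - inner (T u) (T v).
Proof.
move=> Tc.
have [x|T' [TP T'c]] := @adjoint_exists _ _ _ T 1 ler01; first by rewrite mul1r.
pose A x := T' (T x).
have Ac x : rnorm (A x) <= rnorm x.
  by apply: le_trans (Tc x); have := T'c (T x); rewrite mul1r.
have Al u v : inner (A u) v = inner (T u) (T v).
  by rewrite innerC -TP -innerC.
have Ar u v : inner u (A v) = inner (T u) (T v) by rewrite -TP.
pose Y := fix Y n x : H :=
  if n is m.+1 then 2^-1 *: (A x + Y m (Y m x)) else 0.
have YS n x : Y n.+1 x = 2^-1 *: (A x + Y n (Y n x)) by [].
pose q := fix q n : R := if n is m.+1 then (1 + q m ^+ 2) / 2 else 0.
have qS n : q n.+1 = (1 + q n ^+ 2) / 2 by [].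
have q01 n : 0 <= q n <= 1.
  by elim: n => [|n /andP[q0 q1]]; rewrite ?lexx ?ler01// qS; apply/andP; split;
    nra.
have qmono n : q n <= q n.+1 by rewrite qS; have := sqr_ge0 (q n - 1); nra.
have Ylin n : linear (Y n).
  elim: n => [a x y|n IH a x y]; first by rewrite /= scaler0 addr0.
  rewrite !YS !IH /A !linearP scalerA mulrC -scalerA -scalerDr; congr (_ *: _).
  by rewrite scalerDr addrACA.
have YB n x y : Y n (x - y) = Y n x - Y n y.
  by rewrite -[- y]scaleN1r addrC Ylin scaleN1r addrC.
have Ysym n u v : inner (Y n u) v = inner u (Y n v).
  elim: n u v => [|n IH] u v; first by rewrite /= inner0l inner0r.
  rewrite !YS innerZl innerZr innerDl innerDr Al Ar !IH.
  by congr (_ * _); rewrite fmorphV rmorph_nat.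
have Ybd n x : rnorm (Y n x) <= q n * rnorm x.
  elim: n x => [|n IH] x; first by rewrite /= rnorm0 mul0r.
  rewrite YS rnormZ rnorm_half qS.
  have := ler_rnormD (A x) (Y n (Y n x)); have := Ac x.
  have := IH x; have := IH (Y n x); have /andP[] := q01 n.
  nra.
have Ydiff n x : rnorm (Y n.+1 x - Y n x) <= (q n.+1 - q n) * rnorm x.
  elim: n x => [|n IH] x.
    rewrite YS /= subr0 addr0 rnormZ rnorm_half.
    by have := Ac x; nra.
  rewrite [X in X - _]YS [X in _ - X]YS -scalerBr rnormZ rnorm_half.
  (* [A] cancels and the difference of squares is split in two; the bounds add up to
     [(q_(n+1)^2 - q_n^2) |x|], whose half is the next increment of [q]. *)
  have -> : A x + Y n.+1 (Y n.+1 x) - (A x + Y n (Y n x)) =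
      Y n.+1 (Y n.+1 x - Y n x) + (Y n.+1 (Y n x) - Y n (Y n x)).
    by rewrite YB opprD addrACA subrr add0r addrA subrK.
  have := ler_rnormD (Y n.+1 (Y n.+1 x - Y n x)) (Y n.+1 (Y n x) - Y n (Y n x)).
  have := Ybd n.+1 (Y n.+1 x - Y n x); have := IH x; have := IH (Y n x).
  have := Ybd n x; have /andP[] := q01 n; have /andP[] := q01 n.+1.
  have := qmono n; have := qS n; rewrite (qS n.+1).
  move: (q n) (q n.+1) => a b; move: (rnorm x) (rnorm_ge0 x) => X X0.
  move: (rnorm (Y n.+1 x - _)) => N1; move: (rnorm (Y n x)) => N2.
  move: (rnorm (Y n.+1 (_ - _))) => N3; move: (rnorm (_ - Y n (Y n x))) => N4.
  move: (rnorm _) => N5 qb ab b0 b1 a0 a1 h1 h2 h3 h4 h5.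
  have h6 : b * N1 <= b * ((b - a) * X) by rewrite ler_wpM2l.
  have h7 : (b - a) * N2 <= (b - a) * (a * X) by rewrite ler_wpM2l ?subr_ge0.
  have h8 : b * X = (1 + a ^+ 2) / 2 * X by rewrite qb.
  lra.
have Ycauchy x n p : (n <= p)%N -> rnorm (Y p x - Y n x) <= (1 - q n) * rnorm x.
  move=> np; apply: (@le_trans _ _ ((q p - q n) * rnorm x)); last first.
    by rewrite ler_wpM2r ?rnorm_ge0// lerB//; have /andP[] := q01 p.
  elim: p np => [|p IH].
    by rewrite leqn0 => /eqP ->; rewrite !subrr rnorm0 mul0r.
  rewrite leq_eqVlt => /orP[/eqP <-|]; first by rewrite !subrr rnorm0 mul0r.
  rewrite ltnS => /IH; have := Ydiff p x.
  have := ler_rdist (Y p x) (Y p.+1 x) (Y n x).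
  nra.
have qvan : vanishing (fun n => 1 - q n).
  (* The error [d = 1 - q n] evolves by [d - d^2 / 2], which is increasing on [[0, 1]]; so a bound
     [b = 2 / (n + 2) <= 1] may be substituted for [d]. *)
  have qle n : 1 - q n <= 2 / n.+2%:R.
    elim: n => [|n IH]; first by rewrite subr0 divff.
    have -> : 1 - q n.+1 = (1 - q n) - (1 - q n) ^+ 2 / 2 by rewrite qS; field.
    have /andP[q0 q1] := q01 n.
    pose b : R := 2 / n.+2%:R.
    have b1 : b <= 1 by rewrite ler_pdivrMr ?ltr0n// mul1r ler_nat.
    apply: (@le_trans _ _ (b - b ^+ 2 / 2)).
      by move: IH; rewrite -/b; nra.
    rewrite /b -(natr1 n.+2) -subr_ge0.
    have n0 : (0 : R) < n.+2%:R by rewrite ltr0n.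
    move: (n.+2%:R : R) n0 => t t0.
    have -> : 2 / (t + 1) - (2 / t - (2 / t) ^+ 2 / 2) = 2 / (t ^+ 2 * (t + 1)).
      by field; rewrite !gt_eqF//; lra.
    by rewrite divr_ge0// mulr_ge0 ?sqr_ge0//; lra.
  move=> d /(vanishingM (ler0n _ 2) harmonic_vanishing)[n hn]; exists n.
  apply: le_lt_trans (qle n) (le_lt_trans _ hn).
  by rewrite ler_wpM2l// lef_pV2 ?posrE ?ltr0n// ler_nat.
have /choice[Z ZP] x :
    exists z, forall n, rnorm (z - Y n x) <= (1 - q n) * rnorm x.
  apply: rapid_cauchy_limit (Ycauchy x) => d d0.
  have [n hn] := vanishingM (rnorm_ge0 x) qvan d0.
  by exists n; rewrite mulrC.
(* Weak form of [2 Z = A + Z^2], arranged so that it is exactly what the expansion of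
   [<u - Z u, v - Z v>] calls for. *)
have ZE u v :
    inner (Z u) v + inner u (Z v) = inner (T u) (T v) + inner (Z u) (Z v).
  apply/eqP; rewrite -subr_eq0; apply/eqP.
  (* One unit of the factor 4 for each of the four error terms left after replacing [Z] by
     iterates. *)
  apply: (vanishing_eq0 (e := fun n => (4 * rnorm u * rnorm v) * (1 - q n))).
    by apply: vanishingM => //; rewrite !mulr_ge0 ?rnorm_ge0.
  move=> n.
  have YE : inner (Y n.+1 u) v + inner u (Y n.+1 v) =
      inner (T u) (T v) + inner (Y n u) (Y n v).
    rewrite !YS innerZl innerZr !innerDl !innerDr Al Ar Ysym (Ysym n u (Y n v)).
    by rewrite fmorphV rmorph_nat -mulrDr; field.
  have -> : inner (Z u) v + inner u (Z v) -
       (inner (T u) (T v) + inner (Z u) (Z v)) =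
     (inner (Z u - Y n.+1 u) v + inner u (Z v - Y n.+1 v)) +
     (- inner (Z u) (Z v - Y n v) + - inner (Z u - Y n u) (Y n v)).
    rewrite !innerBl !innerBr; move: YE; set a := inner (Y n.+1 u) v.
    by move=> /(canRL (addrK _)) ->; ring.
  have cs1 := cauchy_schwarz (Z u - Y n.+1 u) v.
  have cs2 := cauchy_schwarz u (Z v - Y n.+1 v).
  have cs3 := cauchy_schwarz (Z u) (Z v - Y n v).
  have cs4 := cauchy_schwarz (Z u - Y n u) (Y n v).
  apply: le_trans (ler_rnormD _ _) _.
  have := ler_rnormD (inner (Z u - Y n.+1 u) v) (inner u (Z v - Y n.+1 v)).
  have := ler_rnormD (- inner (Z u) (Z v - Y n v))
    (- inner (Z u - Y n u) (Y n v)).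
  rewrite !rnormN.
  have /andP[q0 q1] := q01 n; have qn1 := qmono n.
  have u0 := rnorm_ge0 u; have v0 := rnorm_ge0 v.
  have Zu : rnorm (Z u) <= rnorm u by have := ZP u 0%N; rewrite /= !subr0 mul1r.
  have b1 : rnorm (Z u - Y n.+1 u) * rnorm v <= (1 - q n) * rnorm u * rnorm v.
    rewrite ler_wpM2r// (le_trans (ZP _ _))// ler_wpM2r//; lra.
  have b2 : rnorm u * rnorm (Z v - Y n.+1 v) <= rnorm u * ((1 - q n) * rnorm v).
    rewrite ler_wpM2l// (le_trans (ZP _ _))// ler_wpM2r//; lra.
  have b3 : rnorm (Z u) * rnorm (Z v - Y n v) <=
      rnorm u * ((1 - q n) * rnorm v).
    by rewrite ler_pM ?rnorm_ge0.
  have b4 : rnorm (Z u - Y n u) * rnorm (Y n v) <=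
      (1 - q n) * rnorm u * rnorm v.
    rewrite ler_pM ?rnorm_ge0//; have := Ybd n v; nra.
  lra.
pose D x := x - Z x.
have DE u v : inner (D u) (D v) = inner u v - inner (T u) (T v).
  rewrite /D innerBl !innerBr; have := ZE u v.
  by move=> /(canRL (addrK _)) ->; ring.
have [|D' D'E] := @linear_packP _ _ _ D.
  apply: gram_linear DE _ => a u v w.
  by rewrite innerDl innerZl linearP innerDl innerZl; ring.
by exists D' => u v; rewrite !D'E.
Qed.

(** The iterates of [x |-> N x + b] from 0 are the partial sums of the Neumann series; their
    increments are dominated by a geometric series of ratio [q]. *)
Lemma neumann_fixpoint H (N : {linear H -> H}) (q : R) (b : H) :
  0 <= q < 1 -> (forall x, rnorm (N x) <= q * rnorm x) ->
  exists x, x = N x + b.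
Proof.
move=> /andP[q0 q1] Nq.
pose u n := iter n (fun x => N x + b) 0.
have uS n : u n.+1 = N (u n) + b by [].
have udiff n : rnorm (u n.+1 - u n) <= q ^+ n * rnorm b.
  elim: n => [|n IH]; first by rewrite uS /= linear0 add0r subr0 mul1r.
  rewrite uS [X in _ - X]uS opprD addrACA subrr addr0 -linearB exprS.
  by have := Nq (u n.+1 - u n); nra.
have ucauchy n p : (n <= p)%N ->
    (1 - q) * rnorm (u p - u n) <= (q ^+ n - q ^+ p) * rnorm b.
  elim: p => [|p IH].
    by rewrite leqn0 => /eqP ->; rewrite !subrr rnorm0 mul0r mulr0.
  rewrite leq_eqVlt => /orP[/eqP <-|].
    by rewrite !subrr rnorm0 mul0r mulr0.
  rewrite ltnS => /IH; have := udiff p; rewrite exprS.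
  have := ler_rdist (u p) (u p.+1) (u n).
  nra.
pose c := rnorm b / (1 - q).
have c0 : 0 <= c by rewrite divr_ge0 ?rnorm_ge0// subr_ge0 ltW.
have qvan : vanishing (fun n => c * q ^+ n).
  apply: vanishingM => // d d0.
  have /cvgrPdist_lt/(_ d d0)[n _ hn] : q ^+ n @[n --> \oo] --> 0.
    by apply: cvg_expr; rewrite ger0_norm.
  exists n; have := hn n (leqnn n).
  by rewrite /= sub0r normrN ger0_norm// exprn_ge0.
have [h hP] : exists h, forall n, rnorm (h - u n) <= c * q ^+ n.
  apply: rapid_cauchy_limit qvan _ => n p /ucauchy.
  have q10 : 0 < 1 - q by rewrite subr_gt0.
  rewrite /c mulrAC ler_pdivlMr// mulrC => /le_trans; apply.
  rewrite mulrC ler_wpM2l ?rnorm_ge0// lerBlDr lerDl exprn_ge0//.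
exists h; apply/eqP; rewrite -subr_eq0; apply/eqP.
apply: (vanishing_eq0 (e := fun n => 2 * (c * q ^+ n))).
  exact: vanishingM.
move=> n; have -> : h - (N h + b) = (h - u n.+1) + - N (h - u n).
  rewrite uS linearB !opprD !opprK.
  by rewrite [RHS](AC ((1*2)*2) ((1*(4*3))*(5*2)))/= subrr addr0.
have := ler_rnormD (h - u n.+1) (- N (h - u n)); rewrite rnormN.
have := hP n; have := hP n.+1; have := Nq (h - u n); rewrite exprS.
have : 0 <= c * q ^+ n by rewrite mulr_ge0// exprn_ge0.
have -> : c * (q * q ^+ n) = q * (c * q ^+ n) by ring.
have := rnorm_ge0 (h - u n).
nra.
Qed.

(* Induction on [r]: splitting off the component of each [h i] along [h x] leaves
   vectors [h' i] with [h' x = 0]. *)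
Lemma schur_product_gram H (J : Type) (h : J -> H) (K : J -> J -> R[i]) :
  (forall (r : seq J) (c : J -> R[i]),
     0 <= \sum_(i <- r) \sum_(j <- r) c j * (c i)^* * K i j) ->
  forall r : seq J, 0 <= \sum_(i <- r) \sum_(j <- r) inner (h j) (h i) * K i j.
Proof.
move=> Kpos r; elim: r h => [h|x r IH h]; first by rewrite big_nil.
(* If [h x = 0] the quotient is 0 and [h' = h]; this degenerate case is treated separately below. *)
pose a i := inner (h i) (h x) / inner (h x) (h x).
pose h' i := h i - a i *: h x.
have hx' i : inner (h' i) (h x) = 0.
  rewrite innerBl innerZl; have [hx0|hx0] := eqVneq (inner (h x) (h x)) 0.
    by rewrite (inner_eq0 hx0) !inner0r mulr0 subrr.
  by rewrite divfK// subrr.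
have hx0 : h' x = 0.
  rewrite /h' /a; have [hx0|hx0] := eqVneq (inner (h x) (h x)) 0.
    by rewrite (inner_eq0 hx0) scaler0 subrr.
  by rewrite divff// scale1r subrr.
(* The cross terms vanish by orthogonality. The component along [h x] gives a rank-one Gram matrix,
   to which the positivity of [K] applies directly. *)
have hE i j : inner (h j) (h i) * K i j =
    inner (h x) (h x) * (a j * (a i)^* * K i j) + inner (h' j) (h' i) * K i j.
  have hD t : h t = a t *: h x + h' t by rewrite addrC subrK.
  move: (hx' i) (hx' j) (hD i) (hD j); move: (h' i) (h' j) => u v ux vx -> ->.
  rewrite !(innerDl, innerDr, innerZl, innerZr) vx (innerC u) ux.
  by rewrite rmorph0; ring.
under eq_bigr => i _ do under eq_bigr => j _ do rewrite hE.
under eq_bigr => i _ do rewrite big_split -mulr_sumr/=.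
rewrite big_split -mulr_sumr/= addr_ge0 ?mulr_ge0 ?inner_ge0 ?Kpos//.
rewrite big_cons big1 ?add0r => [|j _]; last by rewrite hx0 inner0r mul0r.
under eq_bigr => i _ do rewrite big_cons hx0 inner0l mul0r add0r.
exact: IH.
Qed.

End Constructions.

(** * Finite direct sums of Hilbert spaces *)

(** Reduces filters to sequences: centres of balls of radius [1 / (n + 1)] belonging to the filter
    are close because two such balls meet. The free constant [c] leaves room for the loss in passing
    from coordinates to a direct sum. *)
Lemma harmonic_cauchy_complete (R : realType) (V : normedModType R[i]) :
  (forall u : nat -> V,
    (forall n p, (n <= p)%N -> rnorm (u p - u n) <= 2 * n.+1%:R^-1) ->
    exists h c, 0 <= c /\ forall n, rnorm (h - u n) <= c * n.+1%:R^-1) ->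
  forall F : set_system V, ProperFilter F -> cauchy F -> cvg F.
Proof.
move=> Vseq F FF /cauchyP Fc.
have /choice[u uP] n : exists x : V, F (ball x (n.+1%:R^-1 : R)%:C).
  by apply: Fc; rewrite (ltcR 0) invr_gt0 ltr0n.
have uF n (P : set V) : F P -> exists y, P y /\ rnorm (u n - y) < n.+1%:R^-1.
  move=> FP; have [y [Py uy]] := filter_ex (filterI FP (uP n)).
  by exists y; split=> //; move: uy; rewrite -ball_normE/= -rnormE ltcR.
have [n p np|h [c [c0 hP]]] := Vseq u.
  have [y [+ ny]] := uF n _ (uP p); rewrite -ball_normE/= -rnormE ltcR => py.
  have := ler_rdist y (u p) (u n); rewrite (rnormB y).
  have : (p.+1%:R^-1 : R) <= n.+1%:R^-1.
    by rewrite lef_pV2 ?posrE ?ltr0n// ler_nat.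
  move: ny py; set a := (n.+1%:R^-1 : R); set b := (p.+1%:R^-1 : R); lra.
apply/cvg_ex; exists h; apply/cvgrPdist_lt => d d0.
have d0' : 0 < complex.Re d by move: d0; rewrite ltcE => /andP[].
have c1 : 0 <= c + 1 by rewrite addr_ge0.
have [n hn] := vanishingM c1 harmonic_vanishing d0'.
apply: filterS (uP n) => y; rewrite -ball_normE/= -!rnormE ltcR => uy.
have -> : d = (complex.Re d)%:C by rewrite RRe_real// gtr0_real.
rewrite ltcR; have := ler_rdist (u n) h y; have := hP n.
move: uy hn; set a := (n.+1%:R^-1 : R); lra.
Qed.

Section HilbertSum.
Context {R : realType} (n : nat) (G F : hilbertType R).

(** The Hilbert sum of [n] copies of [G] and one of [F]. Only the module structure is inherited; the
    norm comes from [hsum_inner]. *)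
Definition hsum : Type := ({ffun 'I_n -> G} * F)%type.

HB.instance Definition _ := GRing.Lmodule.on hsum.

Definition hsum_inner (x y : hsum) : R[i] :=
  \sum_(l < n) inner (x.1 l) (y.1 l) + inner x.2 y.2.

Lemma hsum_innerC (x y : hsum) :
  hsum_inner x y = (-1) ^+ false * (hsum_inner y x)^*.
Proof.
rewrite expr0 mul1r rmorphD rmorph_sum /= -innerC; congr (_ + _).
by apply: eq_bigr => l _; rewrite -innerC.
Qed.

Lemma hsum_inner_linear y : scalar (hsum_inner^~ y).
Proof.
move=> a u v; rewrite /hsum_inner/= innerDl innerZl mulrDr mulr_sumr addrACA.
rewrite -big_split; congr (_ + _); apply: eq_bigr => l _.
by rewrite !ffunE innerDl innerZl.
Qed.

Lemma hsum_inner_bilinear :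
  bilinear_for *%R (@Num.conj R[i] \; *%R) hsum_inner.
Proof.
split=> [y|x a u v]; first exact: hsum_inner_linear.
rewrite hsum_innerC (hsum_innerC x u) (hsum_innerC x v) hsum_inner_linear.
by rewrite !expr0 !mul1r rmorphD rmorphM.
Qed.

HB.instance Definition _ :=
  bilinear_isBilinear.Build R[i] hsum hsum R[i] *%R (@Num.conj R[i] \; *%R)
    hsum_inner hsum_inner_bilinear.
HB.instance Definition _ :=
  isHermitianSesquilinear.Build R[i] hsum false (@Num.conj R[i])
    hsum_inner hsum_innerC.

Lemma hsum_inner_gt0 (x : hsum) : x != 0 -> 0 < hsum_inner x x.
Proof.
have ge0 : 0 <= \sum_(l < n) inner (x.1 l) (x.1 l).
  by apply: sumr_ge0 => l _; exact: inner_ge0.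
rewrite lt_def addr_ge0 ?inner_ge0// andbT; apply: contra.
rewrite paddr_eq0 ?inner_ge0// psumr_eq0 => [|l _]; last exact: inner_ge0.
move=> /andP[/allP x1 /eqP/inner_eq0 x2]; apply/eqP.
rewrite [x]surjective_pairing x2; congr (_, _); apply/ffunP => l.
rewrite ffunE; apply: inner_eq0; apply/eqP.
by apply: (x1 l); rewrite mem_index_enum.
Qed.

HB.instance Definition _ :=
  isDotProduct.Build R[i] hsum hsum_inner hsum_inner_gt0.

HB.instance Definition _ := Lmodule_isNormed.Build R[i] hsum
  (ler_dot_normD hsum_inner) (dot_normZ hsum_inner)
  (@dot_norm0_eq0 _ _ hsum_inner).

Lemma hsum_innerxx (x : hsum) : hsum_inner x x = `|x| ^+ 2.
Proof. by rewrite -dot_normE. Qed.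

Lemma rnorm_hsum (x : hsum) :
  rnorm x ^+ 2 = \sum_(l < n) rnorm (x.1 l) ^+ 2 + rnorm x.2 ^+ 2.
Proof.
apply: complexI; rewrite rmorphXn/= rnormE -hsum_innerxx rmorphD rmorph_sum/=.
by rewrite -inner_sqr; congr (_ + _); apply: eq_bigr => l _; rewrite inner_sqr.
Qed.

Lemma rnorm_hsum1 (x : hsum) l : rnorm (x.1 l) <= rnorm x.
Proof.
rewrite -ler_sqr ?nnegrE ?rnorm_ge0// rnorm_hsum (bigD1 l)//= -!addrA lerDl.
by rewrite addr_ge0 ?sqr_ge0// sumr_ge0// => i _; exact: sqr_ge0.
Qed.

Lemma rnorm_hsum2 (x : hsum) : rnorm x.2 <= rnorm x.
Proof.
rewrite -ler_sqr ?nnegrE ?rnorm_ge0// rnorm_hsum lerDr.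
by rewrite sumr_ge0// => i _; exact: sqr_ge0.
Qed.

Lemma hsum_complete (A : set_system hsum) : ProperFilter A -> cauchy A -> cvg A.
Proof.
apply: harmonic_cauchy_complete => u uc.
have ve : vanishing (fun k => 2 * k.+1%:R^-1 : R).
  exact: vanishingM harmonic_vanishing.
have /choice[g gP] l :
    exists g : G, forall k, rnorm (g - (u k).1 l) <= 2 * k.+1%:R^-1.
  apply: rapid_cauchy_limit ve _ => k p kp.
  apply: le_trans (uc _ _ kp); apply: le_trans (rnorm_hsum1 _ l).
  by rewrite !ffunE.
have [f fP] : exists f : F, forall k, rnorm (f - (u k).2) <= 2 * k.+1%:R^-1.
  apply: rapid_cauchy_limit ve _ => k p kp.
  by apply: le_trans (uc _ _ kp); apply: le_trans (rnorm_hsum2 _).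
(* There are [n + 1] coordinates, each within [2 / (k + 1)]; the crude bound [n + 1 <= (n + 1)^2]
   avoids a square root. *)
exists ([ffun l => g l], f), (2 * n.+1%:R); split=> // k.
have k0 : (0 : R) <= 2 * k.+1%:R^-1 by rewrite mulr_ge0.
rewrite mulrAC -ler_sqr ?nnegrE ?rnorm_ge0 ?mulr_ge0// rnorm_hsum/=.
apply: (@le_trans _ _
    (\sum_(l < n) (2 * k.+1%:R^-1) ^+ 2 + (2 * k.+1%:R^-1) ^+ 2)).
  apply: lerD; last by rewrite ler_sqr ?nnegrE ?rnorm_ge0.
  by apply: ler_sum => l _; rewrite ler_sqr ?nnegrE ?rnorm_ge0// !ffunE.
rewrite sumr_const card_ord -mulrSr -[leLHS]mulr_natr [leRHS]exprMn.
rewrite ler_wpM2l ?sqr_ge0//.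
by rewrite -natrX ler_nat leq_pmulr.
Qed.

HB.instance Definition _ := Uniform_isComplete.Build hsum hsum_complete.
HB.instance Definition _ := isHilbert.Build R hsum hsum_innerxx.

Lemma inner_hsum (x y : hsum) :
  inner x y = \sum_(l < n) inner (x.1 l) (y.1 l) + inner x.2 y.2.
Proof. by []. Qed.

End HilbertSum.

(** * Contractive multipliers *)

Section Adjoint.
Context {R : realType}.
Implicit Type H K : hilbertType R.

(** Existence of the adjoint, so that [get] does not return a default value. *)
Lemma inner_adjoint H K (A : bounded_op H K) x y :
  inner (A x) y = inner x (adjoint A y).
Proof.
have [c c0 Ac] := continuous_lipschitz (@bop_continuous _ _ _ A).
have [B [BP _]] := adjoint_exists c0 Ac.
have P : exists B : {linear K -> H}, forall x y, inner (A x) y = inner x (B y).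
  by exists (bop_lin B).
exact: (getPex P).
Qed.

Lemma adjoint_unique H K (A : bounded_op H K) (B : K -> H) :
  (forall x y, inner (A x) y = inner x (B y)) -> adjoint A =1 B.
Proof.
by move=> AB y; apply: inner_ext => x; rewrite innerC -inner_adjoint AB -innerC.
Qed.

(** Rescaling to the unit ball. [A] is a plain homogeneous function because [mulop] is obtained by
    choice and carries no linear structure. *)
Lemma opnorm_le1P H K (A : H -> K) : (forall a x, A (a *: x) = a *: A x) ->
  (opnorm A <= 1)%E <-> forall x, rnorm (A x) <= rnorm x.
Proof.
move=> Alin; split=> [A1 x|Ac].
  have [->|x0] := eqVneq x 0.
    by rewrite -[X in A X](scale0r (0 : H)) Alin scale0r !rnorm0.
  have nx0 : 0 < rnorm x.
    by rewrite lt_def rnorm_ge0 andbT; apply: contra x0 => /eqP/rnorm0_eq0 ->.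
  have rc : rnorm ((rnorm x)^-1)%:C = (rnorm x)^-1.
    by rewrite rnorm_real// invr_ge0 ltW.
  have : ((rnorm (A (((rnorm x)^-1)%:C *: x)))%:E <= 1)%E.
    apply: le_trans A1; apply: ereal_sup_ubound.
    exists (((rnorm x)^-1)%:C *: x) => //=.
    by rewrite -rnormE rnormZ rc mulVf ?gt_eqF.
  by rewrite Alin rnormZ rc lee_fin mulrC ler_pdivrMr// mul1r.
apply: ge_ereal_sup => _ [x /= x1 <-]; rewrite lee_fin.
by apply: le_trans (Ac x) _; rewrite -lecR rnormE.
Qed.

End Adjoint.

(** * Kernel vectors, evaluation on tensor products and the multiplier criterion *)

Section KernelVectors.
Context {R : realType} {X : Type} {k : X -> X -> R[i]} (Hk : rkhs k).

Definition kvec (w : X) : Hk := get (fun v : Hk =>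
  (forall z, fun_of v z = k z w) /\ (forall f, inner f v = fun_of f w)).

Lemma inner_kvec (f : Hk) w : inner f (kvec w) = fun_of f w.
Proof.
by have [_ ->] := getPex (fun_of_reproducing Hk w).
Qed.

Lemma fun_of_kvec z w : fun_of (kvec w) z = k z w.
Proof.
by have [-> _] := getPex (fun_of_reproducing Hk w).
Qed.

Lemma inner_kvec2 z w : inner (kvec w) (kvec z) = k z w.
Proof. by rewrite inner_kvec fun_of_kvec. Qed.

Lemma rkhs_eq0 (f : Hk) : (forall w, inner f (kvec w) = 0) -> f = 0.
Proof.
move=> f0; apply: fun_of_inj; apply/funext => w.
by rewrite -!inner_kvec f0 inner0l.
Qed.

End KernelVectors.

Section Tensor.
Context {R : realType} {H K : hilbertType R} (T : htensor H K).

Lemma rnorm_tensor f x : rnorm (tensor T f x) = rnorm f * rnorm x.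
Proof.
apply/eqP; rewrite -(@eqrXn2 _ 2) ?mulr_ge0 ?rnorm_ge0// exprMn; apply/eqP.
by apply: complexI; rewrite -inner_sqr inner_tensor !inner_sqr -rmorphM.
Qed.

(** By density [F] is close to a finite sum [G] of elementary tensors, and [<F, F> = <F, F - G>]. *)
Lemma tensor_orthogonal_eq0 (F : T) :
  (forall f x, inner F (tensor T f x) = 0) -> F = 0.
Proof.
move=> F0; apply: inner_eq0.
apply: (vanishing_eq0 (e := fun n => rnorm F * n.+1%:R^-1)).
  by apply: vanishingM harmonic_vanishing; exact: rnorm_ge0.
move=> n; have e0 : 0 < ((n.+1%:R^-1 : R)%:C) :> R[i].
  by rewrite (ltcR 0) invr_gt0 ltr0n.
have F1 : ball F ((n.+1%:R^-1 : R)%:C) !=set0 by exists F; exact: ballxx.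
have [G [FG [N [f [x GE]]]]] := tensor_dense F1 (ball_open _ _).
move: FG; rewrite -ball_normE/= -rnormE ltcR => /ltW FG.
have -> : inner F F = inner F (F - G).
  by rewrite innerBr GE inner_sumr big1 ?subr0.
by apply: le_trans (cauchy_schwarz _ _) _; rewrite ler_wpM2l ?rnorm_ge0.
Qed.

End Tensor.

Section EvTensor.
Context {R : realType} {X : Type} {k : X -> X -> R[i]} {Hk : rkhs k}.
Context {E : hilbertType R} (T : htensor Hk E).

(** The vector-valued reproducing property. The adjoint of [y |-> k_z (x) y] shows that an
    evaluation operator exists, and the one selected agrees with it on elementary tensors. *)
Lemma inner_ev_tensor z (F : T) (y : E) :
  inner (ev_tensor T z F) y = inner F (tensor T (kvec Hk z) y).
Proof.
have /getPex[S1 S2] : exists S : {linear T -> E}, continuous S /\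
    forall f x, S (tensor T f x) = fun_of f z *: x.
  have Ac (x : E) :
      rnorm (tensor T (kvec Hk z) x) <= rnorm (kvec Hk z) * rnorm x.
    by rewrite rnorm_tensor.
  have [B [BP _]] :=
    @adjoint_exists _ _ _ (tensor T (kvec Hk z)) _ (rnorm_ge0 _) Ac.
  exists (bop_lin B); split=> [|f x]; first exact: bop_continuous.
  apply: inner_ext => u; rewrite innerC -BP -innerC inner_tensor.
  by rewrite inner_kvec innerZl.
have [c c0 Sc] := continuous_lipschitz S1.
have [B [BP _]] := adjoint_exists c0 Sc.
rewrite BP; congr (inner _ _); apply/eqP; rewrite -subr_eq0; apply/eqP.
apply: (tensor_orthogonal_eq0 (T := T)) => f x.
rewrite innerC innerBr -BP S2 inner_tensor inner_kvec innerZl subrr.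
exact: rmorph0.
Qed.

(** For fixed [x], pairing [F - G] with [f (x) x] is represented by a vector of [Hk]; equality of
    the values makes it orthogonal to all kernel vectors. *)
Lemma ev_tensor_inj (F G : T) :
  (forall w, ev_tensor T w F = ev_tensor T w G) -> F = G.
Proof.
move=> FG; apply/eqP; rewrite -subr_eq0; apply/eqP.
apply: tensor_orthogonal_eq0 => f x.
have Alin : linear (fun f => tensor T f x).
  by move=> a g h; rewrite linearPl.
have [A AE] := linear_packP Alin.
have Ac (g : Hk) : rnorm (A g) <= rnorm x * rnorm g.
  by rewrite AE rnorm_tensor mulrC.
have [B [BP _]] := adjoint_exists (rnorm_ge0 _) Ac.
rewrite innerC -AE BP (_ : B (F - G) = 0) ?inner0r ?rmorph0//.
apply: rkhs_eq0 => w; rewrite innerC -BP AE -innerC innerBl.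
by rewrite -!inner_ev_tensor FG subrr.
Qed.

End EvTensor.

Section MultiplierCriterion.
Context {R : realType} {X : Type} {k l : X -> X -> R[i]}.
Context {Hk : rkhs k} {Hl : rkhs l} {F1 F2 : hilbertType R}.
Variables (T1 : htensor Hk F1) (T2 : htensor Hl F2).
Implicit Type Phi : X -> bounded_op F1 F2.

Lemma mulopP Phi (F : T1) (G : T2) : is_product Phi F G -> mulop T2 Phi F = G.
Proof.
move=> FG; apply: ev_tensor_inj => w; rewrite FG.
exact: (getPex (ex_intro _ G FG)).
Qed.

(* The right-hand side says that [M_Phi^*], which maps [l_w (x) y] to
   [k_w (x) Phi(w)^* y], is a contraction. *)
Lemma multiplier1P Phi : multiplier1 T1 T2 Phi <->
  forall r : seq (X * F2),
    rnorm (\sum_(p <- r) tensor T1 (kvec Hk p.1) (adjoint (Phi p.1) p.2)) <=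
    rnorm (\sum_(p <- r) tensor T2 (kvec Hl p.1) p.2).
Proof.
split=> [[Pm P1] r|Pr].
  have mP (F : T1) : is_product Phi F (mulop T2 Phi F).
    by have [G FG] := Pm F; rewrite (mulopP FG).
  have mZ a (F : T1) : mulop T2 Phi (a *: F) = a *: mulop T2 Phi F.
    by apply: mulopP => w; rewrite !linearZ/= mP.
  have {}P1 := (opnorm_le1P mZ).1 P1.
  set t := (X in rnorm X <= _); set u := (X in _ <= rnorm X).
  have mt (F : T1) : inner (mulop T2 Phi F) u = inner F t.
    rewrite !inner_sumr; apply: eq_bigr => p _.
    by rewrite -!inner_ev_tensor mP inner_adjoint.
  (* Testing the weak form of [t = M^* u] at [F = t] gives [|t|^2 <= |M t| |u| <= |t| |u|]. *)
  have := cauchy_schwarz (mulop T2 Phi t) u; rewrite mt inner_sqr.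
  rewrite rnorm_real ?sqr_ge0//; have := P1 t.
  by have := rnorm_ge0 t; have := rnorm_ge0 u; nra.
(* Graph of the future adjoint on kernel vectors. Its contractive extension [C] has an adjoint [M],
   and [M] is multiplication by [Phi]. *)
pose G s b := exists r : seq (X * F2),
  s = \sum_(p <- r) tensor T2 (kvec Hl p.1) p.2 /\
  b = \sum_(p <- r) tensor T1 (kvec Hk p.1) (adjoint (Phi p.1) p.2).
have [||C [Cc CP]] := @contraction_extension _ _ _ G.
- split; first by exists [::]; rewrite !big_nil.
  move=> a _ _ _ _ [r [-> ->]] [r' [-> ->]].
  exists ([seq (p.1, a *: p.2) | p <- r] ++ r').
  rewrite !big_cat/= !big_map !scaler_sumr; split; congr (_ + _);
    by apply: eq_bigr => p _; rewrite /= ?linearZ//= linearZr_LR.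
- by move=> _ _ [r [-> ->]]; exact: Pr.
have Cc' x : rnorm (C x) <= 1 * rnorm x by rewrite mul1r.
have [M [MP Mc]] := adjoint_exists ler01 Cc'.
have prodM (F : T1) : is_product Phi F (M F).
  move=> w; apply: inner_ext => y.
  rewrite inner_ev_tensor (inner_adjoint (Phi w)) inner_ev_tensor.
  rewrite innerC -MP -innerC.
  congr (inner _ _); apply: CP; exists [:: (w, y)].
  by rewrite !big_seq1.
have ME : mulop T2 Phi = M :> (T1 -> T2) by apply/funext => F; exact: mulopP.
split; first by move=> F; exists (M F).
rewrite ME; apply/opnorm_le1P => [a x|x]; first by rewrite linearZ.
by have := Mc x; rewrite mul1r.
Qed.

End MultiplierCriterion.

(** * Transfer functions on the ball *)

Section Ball.
Context {R : realType} {n : nat}.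
Implicit Types z w : unit_ball R n.

Lemma ball_radius z :
  exists q : R, 0 <= q < 1 /\ \sum_(l < n) rnorm (val z 0 l) ^+ 2 = q ^+ 2.
Proof.
have z1 : \sum_(l < n) rnorm (val z 0 l) ^+ 2 < 1.
  rewrite -ltcR rmorph_sum; apply: le_lt_trans (svalP z).
  by apply: ler_sum => l _; rewrite -rnormE rmorphXn.
have z0 : 0 <= \sum_(l < n) rnorm (val z 0 l) ^+ 2.
  by apply: sumr_ge0 => l _; exact: sqr_ge0.
exists (Num.sqrt (\sum_(l < n) rnorm (val z 0 l) ^+ 2)).
by rewrite sqr_sqrtr// sqrtr_ge0 -[X in _ < X]sqrtr1 ltr_sqrt.
Qed.

(** [2 a b <= a^2 + b^2] in each coordinate gives [|<z, w>| < 1]; hence the inverse in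
    [drury_arveson] is a genuine one. *)
Lemma cdot_neq1 z w : 1 - cdot (val z) (val w) != 0.
Proof.
rewrite subr_eq0 eq_sym; apply/eqP => c1.
have : rnorm (cdot (val z) (val w)) = 1 by rewrite c1 (rnorm_real ler01).
apply/eqP; rewrite lt_eqF//.
have [p [/andP[p0 p1] zp]] := ball_radius z.
have [q [/andP[q0 q1] wq]] := ball_radius w.
apply: (@le_lt_trans _ _ (2^-1 * (p ^+ 2 + q ^+ 2))); last by nra.
apply: (@le_trans _ _ (\sum_(l < n) rnorm (val z 0 l) * rnorm (val w 0 l))).
  rewrite /cdot; elim/big_ind2 : _ => [|x1 x2 y1 y2 h1 h2|l _].
  - by rewrite rnorm0.
  - by apply: le_trans (ler_rnormD _ _) _; exact: lerD.
  - by rewrite rnormM rnorm_conj.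
rewrite -zp -wq -big_split mulr_sumr; apply: ler_sum => l _ /=.
by have := sqr_ge0 (rnorm (val z 0 l) - rnorm (val w 0 l)); nra.
Qed.

End Ball.

Section GramSums.
Context {R : realType}.

Lemma inner_sum2 (H : hilbertType R) (I J : Type) (r : seq I) (s : seq J)
    (u : J -> H) (v : I -> H) :
  inner (\sum_(j <- s) u j) (\sum_(i <- r) v i) =
  \sum_(i <- r) \sum_(j <- s) inner (u j) (v i).
Proof. by rewrite inner_sumr; apply: eq_bigr => i _; rewrite inner_suml. Qed.

Lemma inner_kernel_sum (X : Type) (k : X -> X -> R[i]) (Hk : rkhs k)
    (E : hilbertType R) (T : htensor Hk E) (I : Type) (r : seq I) (w : I -> X)
    (x : I -> E) :
  let u := \sum_(i <- r) tensor T (kvec Hk (w i)) (x i) in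
  inner u u = \sum_(i <- r) \sum_(j <- r) k (w i) (w j) * inner (x j) (x i).
Proof.
rewrite /= inner_sum2; apply: eq_bigr => i _; apply: eq_bigr => j _.
by rewrite inner_tensor inner_kvec2.
Qed.

End GramSums.

Section Transfer.
Context {R : realType} {n : nat} {G F E : hilbertType R}.
Variable U : bounded_op (hsum n G F) (hsum 1 G E).
Hypothesis U_le1 : forall x, rnorm (U x) <= rnorm x.

(** The vector fed to the colligation [U] at [w]: the adjoint of the row [(w_1, ..., w_n)] applied
    to the state [g], with external input [f]. The conjugates produce [cdot v w] in Gram
    matrices. *)
Definition scaled_state (w : unit_ball R n) (g : G) (f : F) : hsum n G F :=
  ([ffun l => (val w 0 l)^* *: g], f).

Lemma scaled_stateP w a g f g' f' :
  scaled_state w (a *: g + g') (a *: f + f') =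
  a *: scaled_state w g f + scaled_state w g' f'.
Proof.
congr (_, _); apply/ffunP => l; rewrite !ffunE scalerDr !scalerA.
by rewrite mulrC.
Qed.

Lemma inner_scaled_state v w g f h e :
  inner (scaled_state w g f) (scaled_state v h e) =
  cdot (val v) (val w) * inner g h + inner f e.
Proof.
rewrite inner_hsum/= mulr_suml; congr (_ + _); apply: eq_bigr => l _.
by rewrite !ffunE innerZl innerZr conjCK; ring.
Qed.

(** The state equation reads [x = N x + b], with [N] of norm at most [|w| < 1]. A Neumann series
    solves it, and uniqueness makes the solution linear in [f]. *)
Lemma transfer_state w : exists g : {linear F -> G}, forall f x,
  x = (U (scaled_state w x f)).1 ord0 <-> x = g f.
Proof.
have [q [q01 wq]] := ball_radius w; have /andP[q0 q1] := q01.
pose N x := (U (scaled_state w x 0)).1 ord0.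
have US x f : (U (scaled_state w x f)).1 ord0 =
    N x + (U (scaled_state w 0 f)).1 ord0.
  have -> : scaled_state w x f = scaled_state w x 0 + scaled_state w 0 f.
    have := scaled_stateP w 1 x 0 0 f.
    by rewrite !scale1r addr0 add0r => ->.
  by rewrite linearD/= ffunE.
have Nlin : linear N.
  move=> a x y; rewrite /N -[X in scaled_state _ _ X](addr0 (0 : F)).
  rewrite -[X in scaled_state _ _ (X + _)](scaler0 _ a) scaled_stateP.
  by rewrite linearP/= !ffunE.
have Nq x : rnorm (N x) <= q * rnorm x.
  apply: le_trans (rnorm_hsum1 _ _) _; apply: le_trans (U_le1 _) _.
  rewrite -ler_sqr ?nnegrE ?mulr_ge0 ?rnorm_ge0// rnorm_hsum/=.
  rewrite rnorm0 expr0n addr0 exprMn -wq mulr_suml; apply: ler_sum => l _.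
  by rewrite ffunE rnormZ rnorm_conj exprMn.
have [N' N'E] := linear_packP Nlin.
have N'q x : rnorm (N' x) <= q * rnorm x by rewrite N'E.
have N0 x : x = N x -> x = 0.
  move=> xN; apply: rnorm0_eq0; apply/eqP; rewrite eq_le rnorm_ge0 andbT.
  by have := Nq x; rewrite -xN; have := rnorm_ge0 x; nra.
have Nuniq x y b : x = N x + b -> y = N y + b -> x = y.
  move=> xN yN; apply/eqP; rewrite -subr_eq0; apply/eqP/N0.
  rewrite -N'E linearB !N'E [in LHS]xN [in LHS]yN opprD.
  by rewrite addrACA subrr addr0.
have /choice[g gP] f : exists x, x = (U (scaled_state w x f)).1 ord0.
  have [x xN] := neumann_fixpoint ((U (scaled_state w 0 f)).1 ord0) q01 N'q.
  by exists x; rewrite US {1}xN N'E.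
have glin : linear g.
  move=> a f f'.
  apply: (Nuniq _ _ ((U (scaled_state w 0 (a *: f + f'))).1 ord0)).
    by rewrite -US.
  by rewrite -US scaled_stateP linearP/= !ffunE -!gP.
have [g' g'E] := linear_packP glin.
exists g' => f x; rewrite g'E; split=> [xU|->]; last exact: gP.
by apply: (Nuniq _ _ ((U (scaled_state w 0 f)).1 ord0)); rewrite -US.
Qed.

(* The realization formula: [Phi(w)^*] is the transfer function of [U]. *)
Lemma transfer_multiplier (H2 : rkhs (@drury_arveson R n)) (T1 : htensor H2 E)
    (T2 : htensor H2 F) :
  exists Phi : unit_ball R n -> bounded_op E F, multiplier1 T1 T2 Phi /\
    forall w f x, x = (U (scaled_state w x f)).1 ord0 ->
      adjoint (Phi w) f = (U (scaled_state w x f)).2.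
Proof.
have /choice[g gP] := transfer_state.
pose V w f := scaled_state w (g w f) f.
pose S w f := (U (V w f)).2.
have gE w f : (U (V w f)).1 ord0 = g w f by rewrite -(gP w f _).2.
have innerUV w f v e : inner (U (V w f)) (U (V v e)) =
    inner (g w f) (g v e) + inner (S w f) (S v e).
  by rewrite inner_hsum big_ord1 !gE.
have /choice[Phi PhiP] w : exists P : bounded_op E F,
    forall f, adjoint P f = S w f.
  have Slin : linear (S w).
    by move=> a f f'; rewrite /S /V linearP scaled_stateP linearP.
  have [S' S'E] := linear_packP Slin.
  (* Contractivity of [U] at one vector: [|g|^2 + |S f|^2 <= q^2 |g|^2 + |f|^2] with [q < 1]. *)
  have S'1 f : rnorm (S' f) <= 1 * rnorm f.
    rewrite mul1r -ler_inner S'E.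
    have : inner (U (V w f)) (U (V w f)) <= inner (V w f) (V w f).
      by rewrite ler_inner.
    rewrite innerUV inner_scaled_state.
    have [q [/andP[q0 q1] wq]] := ball_radius w.
    have -> : cdot (val w) (val w) = (q ^+ 2)%:C.
      rewrite -wq rmorph_sum; apply: eq_bigr => l _.
      by rewrite -normCK -rnormE rmorphXn.
    rewrite !inner_sqr -rmorphM -!rmorphD !lecR.
    have : q ^+ 2 * rnorm (g w f) ^+ 2 <= rnorm (g w f) ^+ 2.
      by rewrite ler_piMl ?sqr_ge0// expr_le1// ltW.
    lra.
  have [P [PP _]] := adjoint_exists ler01 S'1.
  exists P; apply: adjoint_unique => x y.
  by rewrite innerC -PP S'E -innerC.
exists Phi; split; last first.
  by move=> w f x /gP xg; rewrite PhiP /S /V xg.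
apply/multiplier1P => r.
rewrite -ler_inner !inner_kernel_sum -subr_ge0 -sumrB.
pose K i j :=
  inner (V j.1 j.2) (V i.1 i.2) - inner (U (V j.1 j.2)) (U (V i.1 i.2)).
(* Here [K i j] equals [<f_j, f_i> - <S_j, S_i>] minus [(1 - <w_i, w_j>) <g_j, g_i>]; multiplication
   by the Drury-Arveson kernel turns the last term into the Gram matrix of the states. *)
have -> : \sum_(i <- r) (\sum_(j <- r) drury_arveson i.1 j.1 * inner j.2 i.2 -
    \sum_(j <- r) drury_arveson i.1 j.1 *
      inner (adjoint (Phi j.1) j.2) (adjoint (Phi i.1) i.2)) =
  \sum_(i <- r) \sum_(j <- r) inner (kvec H2 j.1) (kvec H2 i.1) * K i j +
  \sum_(i <- r) \sum_(j <- r) inner (g j.1 j.2) (g i.1 i.2).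
  rewrite -big_split; apply: eq_bigr => i _; rewrite -sumrB -big_split.
  apply: eq_bigr => j _.
  rewrite /= !PhiP inner_kvec2 /K innerUV inner_scaled_state.
  by rewrite /drury_arveson; field; exact: cdot_neq1.
rewrite addr_ge0 -?inner_sum2 ?inner_ge0//.
apply: schur_product_gram => s c.
(* Positivity of [K] is the contractivity of [U] on the span of the inputs. *)
have -> : \sum_(i <- s) \sum_(j <- s) c j * (c i)^* * K i j =
    let v := \sum_(i <- s) c i *: V i.1 i.2 in inner v v - inner (U v) (U v).
  rewrite /= linear_sum !inner_sum2 -sumrB; apply: eq_bigr => i _.
  rewrite -sumrB; apply: eq_bigr => j _.
  have UZ a x : U (a *: x) = a *: U x by rewrite linearZ.
  by rewrite !UZ !(innerZl, innerZr) /K; ring.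
by rewrite /= subr_ge0 ler_inner.
Qed.

End Transfer.

(** * Interpolation *)

Section Interpolation.
Context {R : realType} {m : nat} {E2 : hilbertType R}.

(** The inequality makes the correspondence between the two sums a contractive linear relation,
    which then extends. It yields first [T], then the colligation [U]. *)
Lemma family_contraction (H K : hilbertType R)
    (u : 'I_m -> E2 -> H) (v : 'I_m -> E2 -> K) :
  (forall j, linear (u j)) -> (forall j, linear (v j)) ->
  (forall eta : 'I_m -> E2,
    rnorm (\sum_j v j (eta j)) <= rnorm (\sum_j u j (eta j))) ->
  exists C : bounded_op H K, (forall x, rnorm (C x) <= rnorm x) /\
    forall j eta, C (u j eta) = v j eta.
Proof.
move=> ulin vlin uv.
have u0 j : u j 0 = 0 by have [f <-] := linear_packP (ulin j); rewrite linear0.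
have v0 j : v j 0 = 0 by have [f <-] := linear_packP (vlin j); rewrite linear0.
have [||C [Cc CP]] := @contraction_extension _ _ _ (fun s b =>
    exists eta : 'I_m -> E2, s = \sum_j u j (eta j) /\ b = \sum_j v j (eta j)).
- split; first by exists (fun=> 0); rewrite !big1.
  move=> a _ _ _ _ [eta [-> ->]] [xi [-> ->]].
  exists (fun j => a *: eta j + xi j).
  rewrite !scaler_sumr -!big_split.
  by split; apply: eq_bigr => j _; rewrite ?ulin ?vlin.
- by move=> _ _ [eta [-> ->]].
exists C; split=> // j eta; apply: CP.
exists (fun i => if i == j then eta else 0).
rewrite (bigD1 j)//= eqxx big1 ?addr0 => [|i /negPf ->//].
by rewrite (bigD1 j)//= eqxx big1 ?addr0 => [|i /negPf ->//].
Qed.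

Context {n : nat} {E1 F : hilbertType R}.
Variables (H2 : rkhs (@drury_arveson R n)).
Variables (T1 : htensor H2 E1) (T2 : htensor H2 F) (z : 'I_m -> unit_ball R n).
Variables (A : 'I_m -> {linear E2 -> F}) (B : 'I_m -> {linear E2 -> E1}).

(* The lurking isometry argument: the defect operator of the contraction [T]
   provides the state space, so that the vectors
   [(conj z_j (x) L j eta, A j eta)] and [(L j eta, B j eta)] have the same
   Gram matrix. *)
Lemma leech_interpolation :
  (forall eta : 'I_m -> E2,
    rnorm (\sum_j tensor T1 (kvec H2 (z j)) (B j (eta j))) <=
    rnorm (\sum_j tensor T2 (kvec H2 (z j)) (A j (eta j)))) ->
  exists Phi : unit_ball R n -> bounded_op E1 F, multiplier1 T1 T2 Phi /\
    forall j eta, adjoint (Phi (z j)) (A j eta) = B j eta.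
Proof.
move=> AB.
pose u j x := tensor T2 (kvec H2 (z j)) (A j x).
pose t j x := tensor T1 (kvec H2 (z j)) (B j x).
have ulin j : linear (u j).
  by move=> a x y; rewrite /u linearP linearPr.
have tlin j : linear (t j).
  by move=> a x y; rewrite /t linearP linearPr.
have [T [Tc TP]] := family_contraction ulin tlin AB.
have [D DP] := defect_operator Tc.
pose L j x := D (u j x).
have LP j i x y : inner (L j x) (L i y) =
    drury_arveson (z i) (z j) * (inner (A j x) (A i y) - inner (B j x) (B i y)).
  by rewrite DP !TP !inner_tensor inner_kvec2 mulrBr.
pose v j x := scaled_state (z j) (L j x) (A j x).
pose w j x : hsum 1 T2 E1 := ([ffun=> L j x], B j x).
have Llin j : linear (L j) by move=> a x y; rewrite /L ulin linearP.
have vlin j : linear (v j).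
  by move=> a x y; rewrite /v Llin linearP scaled_stateP.
have wlin j : linear (w j).
  move=> a x y; rewrite /w Llin linearP; congr (_, _).
  by apply/ffunP => l; rewrite !ffunE.
have [eta|U [Uc UP]] := family_contraction vlin wlin.
  (* The two norms are equal: multiplying [LP] by [1 - <z_i, z_j>] shows that the Gram matrices
     agree entrywise. *)
  rewrite -ler_inner !inner_sum2 le_eqVlt; apply/orP; left; apply/eqP.
  apply: eq_bigr => i _; apply: eq_bigr => j _.
  rewrite /v inner_scaled_state inner_hsum big_ord1/= !ffunE LP.
  by rewrite /drury_arveson; field; exact: cdot_neq1.
have [Phi [Phi1 PhiP]] := transfer_multiplier Uc T1 T2.
exists Phi; split=> // j eta.
(* [U] sends [v j eta] to [(L j eta, B j eta)]: hence [L j eta] solves the state equation, and the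
   output is [B j eta]. *)
by rewrite (PhiP _ _ (L j eta)) -/(v j eta) UP//= ffunE.
Qed.

End Interpolation.

(** * Boundedness of evaluation and equivalence of the three conditions *)

Section EvBound.
Context {R : realType} {X : Type} {k : X -> X -> R[i]} {Hk : rkhs k}.
Context {E : hilbertType R} (T : htensor Hk E).

(** Reproducing property and Cauchy-Schwarz with the tensor of [k_w] and the value itself. It makes
    the composite of [Psi_k(w)] with a bounded operator bounded. *)
Lemma rnorm_ev_tensor w (F : T) :
  rnorm (ev_tensor T w F) <= rnorm (kvec Hk w) * rnorm F.
Proof.
have := cauchy_schwarz F (tensor T (kvec Hk w) (ev_tensor T w F)).
rewrite -inner_ev_tensor inner_sqr rnorm_real ?sqr_ge0// rnorm_tensor.
have c0 : 0 <= rnorm (kvec Hk w) * rnorm F by rewrite mulr_ge0 ?rnorm_ge0.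
move=> h; rewrite leNgt; apply/negP => lt.
by have := le_lt_trans c0 lt; nra.
Qed.

End EvBound.

Theorem theorem5p1 (R : realType) (n : nat) (n_ge1 : (1 <= n)%N)
    (E1 E2 : hilbertType R)
    (k kt : unit_ball R n -> unit_ball R n -> R[i])
    (k_regular : regular_kernel k) (kt_kernel : is_kernel kt)
    (k_factor : forall z w, k z w = drury_arveson z w * kt z w)
    (H2 : rkhs (@drury_arveson R n)) (Hk : rkhs k) (Hkt : rkhs kt)
    (H2E1 : htensor H2 E1) (HkE2 : htensor Hk E2)
    (HktE2 : htensor Hkt E2) (H2HktE2 : htensor H2 HktE2)
    (m : nat) (m_ge1 : (1 <= m)%N)
    (z : 'I_m -> unit_ball R n) (W : 'I_m -> bounded_op E1 E2)
    (W_lt1 : forall i, (opnorm (W i) < 1)%E) :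
  let cond_i :=
    exists Phi : unit_ball R n -> bounded_op E1 E2,
      multiplier1 H2E1 HkE2 Phi /\
      forall i x, Phi (z i) x = W i x in
  let cond_ii :=
    forall eta : 'I_m -> E2,
      0 <= \sum_(i < m) \sum_(j < m)
        inner (k (z i) (z j) *: eta j
               - (1 - cdot (val (z i)) (val (z j)))^-1
                   *: W i (adjoint (W j) (eta j)))
              (eta i) in
  let cond_iii :=
    exists Phit : unit_ball R n -> bounded_op E1 HktE2,
      multiplier1 H2E1 H2HktE2 Phit /\
      forall i x, ev_tensor HktE2 (z i) (Phit (z i) x) = W i x in
  (cond_i <-> cond_ii) /\ (cond_ii <-> cond_iii).
Proof.
have gramE (eta : 'I_m -> E2) :
    (rnorm (\sum_j tensor H2E1 (kvec H2 (z j)) (adjoint (W j) (eta j))) <=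
     rnorm (\sum_j tensor HkE2 (kvec Hk (z j)) (eta j))) =
    (0 <= \sum_(i < m) \sum_(j < m)
        inner (k (z i) (z j) *: eta j
               - (1 - cdot (val (z i)) (val (z j)))^-1
                   *: W i (adjoint (W j) (eta j)))
              (eta i)).
  rewrite -ler_inner !inner_kernel_sum -subr_ge0 -sumrB; congr (0 <= _).
  apply: eq_bigr => i _; rewrite -sumrB; apply: eq_bigr => j _.
  by rewrite innerBl !innerZl inner_adjoint.
have tensorE (r : seq (unit_ball R n * E2)) :
    rnorm (\sum_(p <- r) tensor H2HktE2 (kvec H2 p.1)
      (tensor HktE2 (kvec Hkt p.1) p.2)) =
    rnorm (\sum_(p <- r) tensor HkE2 (kvec Hk p.1) p.2).
  apply/eqP; rewrite eq_le -!ler_inner -eq_le; apply/eqP.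
  rewrite !inner_kernel_sum; apply: eq_bigr => i _; apply: eq_bigr => j _.
  by rewrite inner_tensor inner_kvec2 k_factor mulrA.
have i_ii : (exists Phi : unit_ball R n -> bounded_op E1 E2,
    multiplier1 H2E1 HkE2 Phi /\ forall i x, Phi (z i) x = W i x) ->
  forall eta : 'I_m -> E2,
    rnorm (\sum_j tensor H2E1 (kvec H2 (z j)) (adjoint (W j) (eta j))) <=
    rnorm (\sum_j tensor HkE2 (kvec Hk (z j)) (eta j)).
  move=> [Phi [/multiplier1P PhiP PhiW]] eta.
  have := PhiP [seq (z j, eta j) | j <- index_enum 'I_m]; rewrite !big_map/=.
  under eq_bigr => j _.
    have -> : adjoint (Phi (z j)) (eta j) = adjoint (W j) (eta j).
      by apply: adjoint_unique => x y; rewrite PhiW inner_adjoint.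
    over.
  exact.
have ii_iii : (forall eta : 'I_m -> E2,
    rnorm (\sum_j tensor H2E1 (kvec H2 (z j)) (adjoint (W j) (eta j))) <=
    rnorm (\sum_j tensor HkE2 (kvec Hk (z j)) (eta j))) ->
  exists Phit : unit_ball R n -> bounded_op E1 HktE2,
    multiplier1 H2E1 H2HktE2 Phit /\
    forall i x, ev_tensor HktE2 (z i) (Phit (z i) x) = W i x.
  move=> WP.
  have Alin j : linear (fun x => tensor HktE2 (kvec Hkt (z j)) x).
    by move=> a x y; rewrite linearPr.
  have /choice[A AE] j := linear_packP (Alin j).
  have [eta|Phi [Phi1 PhiP]] := @leech_interpolation _ _ _ _ _ _ _ H2E1 H2HktE2
      z A (fun j => adjoint (W j)).
    have := tensorE [seq (z j, eta j) | j <- index_enum 'I_m].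
    rewrite !big_map/= => tE.
    by under [X in _ <= rnorm X]eq_bigr => j _ do rewrite AE; rewrite tE.
  (* The adjoint of [Psi_k(z_i)] sends [y] to [A i y], so the identity in [PhiP] is the
     interpolation condition read through adjoints. *)
  exists Phi; split=> // i x; apply: inner_ext => y.
  by rewrite inner_ev_tensor !inner_adjoint -AE PhiP.
have iii_i : (exists Phit : unit_ball R n -> bounded_op E1 HktE2,
    multiplier1 H2E1 H2HktE2 Phit /\
    forall i x, ev_tensor HktE2 (z i) (Phit (z i) x) = W i x) ->
  exists Phi : unit_ball R n -> bounded_op E1 E2,
    multiplier1 H2E1 HkE2 Phi /\ forall i x, Phi (z i) x = W i x.
  move=> [Phit [/multiplier1P PhitP PhitW]].
  have /choice[Phi PhiE] w : exists P : bounded_op E1 E2,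
      forall x, P x = ev_tensor HktE2 w (Phit w x).
    have [c c0 Pc] := continuous_lipschitz (@bop_continuous _ _ _ (Phit w)).
    apply: (@bounded_opP _ _ _ _ (rnorm (kvec Hkt w) * c)) => [a x y|x].
      by rewrite !linearP.
    apply: le_trans (rnorm_ev_tensor _ _) _.
    by rewrite -mulrA ler_wpM2l ?rnorm_ge0.
  exists Phi; split; last by move=> i x; rewrite PhiE.
  apply/multiplier1P => r; rewrite -tensorE.
  (* The criterion for [Phit] is used at vectors [kt_w (x) y] only; there its adjoint agrees with
     that of [Phi], and [tensorE] identifies the norms on the other side. *)
  have := PhitP [seq (p.1, tensor HktE2 (kvec Hkt p.1) p.2) | p <- r].
  rewrite !big_map/=; under [X in _ -> rnorm X <= _]eq_bigr => p _.
    have -> : adjoint (Phi p.1) p.2 =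
        adjoint (Phit p.1) (tensor HktE2 (kvec Hkt p.1) p.2).
      apply: (@adjoint_unique _ _ _ _
        (fun y => adjoint (Phit p.1) (tensor HktE2 (kvec Hkt p.1) y))) => x y.
      by rewrite PhiE inner_ev_tensor inner_adjoint.
    over.
  exact.
move=> cond_i cond_ii cond_iii.
have iiE : cond_ii <-> forall eta : 'I_m -> E2,
    rnorm (\sum_j tensor H2E1 (kvec H2 (z j)) (adjoint (W j) (eta j))) <=
    rnorm (\sum_j tensor HkE2 (kvec Hk (z j)) (eta j)).
  by split=> c eta; [rewrite gramE | rewrite -gramE].
by split; split; [move/i_ii/iiE | move/iiE/ii_iii/iii_i | move/iiE/ii_iii
  | move/iii_i/i_ii/iiE].
Qed.
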